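(* Let $f$ satisfy Assumption (M) with exponent $p>1$. Then there exist $C^+=C^+(f,N)>0$ and $\varepsilon_0>0$ such that for every $\varepsilon\in(0,\varepsilon_0)$ there is $L_\varepsilon>0$, with $L_\varepsilon\sim C^+\varepsilon^{-\frac{p-1}{2}}\left(\ln\frac1\varepsilon\right)^{1/2}$ as $\varepsilon\to0$, such that for every $L>L_\varepsilon$ the solution $u$ of $u_t=\Delta u+f(u)$ on $(0,\infty)\times\mathbb R^N$ with $u(0,x)=\varepsilon\mathbf 1_{B_L}(x)$ satisfies $u(t,x)\to1$ as $t\to+\infty$, locally uniformly in $x\in\mathbb R^N$.
   Context: Assumption (M): $f:\mathbb R\to\mathbb R$ is locally Lipschitz continuous, $f=0$ on $(-\infty,0]\cup[1,\infty)$, $f(u)>0$ for all $u\in(0,1)$, and for some $p>1$, $0<\liminf_{u\to0^+}f(u)/u^p\le\limsup_{u\to0^+}f(u)/u^p<+\infty$. $B_L$ is the open ball of radius $L$ centred at $0$ in $\mathbb R^N$. *)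

(* Defs.v *)
From Stdlib Require Import Reals Lra.
From Stdlib Require Vectors.Fin.
Open Scope R_scope.

Definition RN (N : nat) : Type := Fin.t N -> R.

Fixpoint fsum (N : nat) : (Fin.t N -> R) -> R :=
  match N return (Fin.t N -> R) -> R with
  | O => fun _ => 0
  | S n => fun g => g Fin.F1 + fsum n (fun i => g (Fin.FS i))
  end.

Definition sqnorm {N : nat} (x : RN N) : R := fsum N (fun i => x i ^ 2).
Definition sqdist {N : nat} (x y : RN N) : R := fsum N (fun i => (x i - y i) ^ 2).

Definition shift {N : nat} (x : RN N) (i : Fin.t N) (h : R) : RN N :=
  fun j => if Fin.eq_dec i j then x j + h else x j.

Definition is_partial {N : nat} (g : RN N -> R) (x : RN N) (i : Fin.t N) (d : R) : Prop :=
  derivable_pt_lim (fun h => g (shift x i h)) 0 d.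

Definition is_second_partial {N : nat} (g : RN N -> R) (x : RN N) (i : Fin.t N) (d2 : R) : Prop :=
  exists d1 : R -> R,
    (forall h, is_partial g (shift x i h) i (d1 h)) /\ derivable_pt_lim d1 0 d2.

Definition ball_data {N : nat} (eps L : R) : RN N -> R :=
  fun x => if Rlt_dec (sqnorm x) (L ^ 2) then eps else 0.

Definition locally_lipschitz (f : R -> R) : Prop :=
  forall a b : R, exists K : R, forall x y : R,
    a <= x <= b -> a <= y <= b -> Rabs (f x - f y) <= K * Rabs (x - y).

Definition assumption_M (f : R -> R) (p : R) : Prop :=
  1 < p /\
  locally_lipschitz f /\
  (forall u, u <= 0 -> f u = 0) /\
  (forall u, 1 <= u -> f u = 0) /\
  (forall u, 0 < u < 1 -> 0 < f u) /\
  (* 0 < liminf_{u->0+} f(u)/u^p <= limsup_{u->0+} f(u)/u^p < +oo, written out *)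
  (exists c1 c2 delta : R, 0 < c1 /\ 0 < delta /\
     forall u, 0 < u < delta ->
       c1 <= f u / Rpower u p /\ f u / Rpower u p <= c2).

Definition is_solution (N : nat) (f : R -> R) (u0 : RN N -> R) (u : R -> RN N -> R) : Prop :=
  (forall x, u 0 x = u0 x) /\
  (exists M : R, forall t x, 0 < t -> Rabs (u t x) <= M) /\
  (forall t x, 0 < t -> forall e, 0 < e -> exists d, 0 < d /\
     forall s y, 0 < s -> Rabs (s - t) < d -> sqdist y x < d ^ 2 ->
       Rabs (u s y - u t x) < e) /\
  (forall x,
     (forall e, 0 < e -> exists d, 0 < d /\ forall y, sqdist y x < d ^ 2 ->
        Rabs (u0 y - u0 x) < e) ->
     forall e, 0 < e -> exists d, 0 < d /\
       forall s y, 0 < s < d -> sqdist y x < d ^ 2 -> Rabs (u s y - u0 x) < e) /\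
  (forall t x, 0 < t ->
     exists (ut : R) (d2 : Fin.t N -> R),
       derivable_pt_lim (fun s => u s x) t ut /\
       (forall i, is_second_partial (u t) x i (d2 i)) /\
       ut = fsum N d2 + f (u t x)).

Definition converges_loc_unif_to_1 {N : nat} (u : R -> RN N -> R) : Prop :=
  forall Rad eta, 0 < Rad -> 0 < eta -> exists T, forall t x,
    T < t -> sqnorm x <= Rad ^ 2 -> Rabs (u t x - 1) < eta.

(* Main.v *)
(* All comparisons are with explicit radial subsolutions. If [F] is a subsolution of the heat
   equation and [Y(t, F)] is the flow of [y' = c y^p], then [Y(t, F)] is a subsolution of
   [u_t = Delta u + c u^p], because the flow is convex in its initial value. Starting from
   [eps (1 - exp (s t + g (|x|^2 - l)))] with [g ~ eps^(p-1)] and [l = L_eps^2], diffusion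
   lowers the initial value near the origin, up to the ODE blow-up time of order
   [eps^(1-p)], only by a relative amount [exp (- const g l)]. This has to be [o(eps^(p-1))]
   for [u] to reach order one, and that is what the factor [(ln (1/eps))^(1/2)] provides. Once
   [u >= A] on a large fixed ball, the subsolution [A (1 - |x|^2 / (l0 + t))^3] spreads, so that
   [u >= A / 8] on balls of radius tending to infinity. On such balls the first construction,
   with [A / 8] in place of [eps], raises [u] above [1 - eta]. *)
From Stdlib Require Import Reals Lra Classical ClassicalEpsilon FunctionalExtensionality.
From Coquelicot Require Import Coquelicot.
Require Import Defs.
Open Scope R_scope.

(** * Points of R^N *)

(** The logarithm can be read off from y^(-b), b = p - 1, which decreases linearly along y' = c
    y^(b+1). Started from eps F instead of eps, this quantity is larger by eps^(-b) (F^(-b) - 1) at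
    all later times, and y comes close to the level reached from eps only if this excess is small.
    Hence 1 - F must be a small multiple of eps^b at most; as g is a fixed multiple of eps^b, g l
    has to be of order ln (1/eps).

    The other difficulty is the weak notion of solution: bounded, continuous for t > 0, satisfying
    the equation pointwise, and attaining the initial value only where that value is continuous.
    Everything therefore rests on maximum principles at a first touching point, for which
    compactness of cubes and decay at infinity have to be arranged. Nothing is known initially on
    the sphere |x| = L, where the data jump; this calls for a separate barrier in the proof of 0 <=
    u <= 1. These bounds come from the vanishing of f outside (0,1), and afterwards only the
    Lipschitz constant of f on [0,1] matters. *)

Lemma fsum_ext N (g h : Fin.t N -> R) :
  (forall i, g i = h i) -> fsum N g = fsum N h.
Proof.
  intros E. f_equal. now apply functional_extensionality.
Qed.

Lemma fsum_lin N (g h : Fin.t N -> R) (a b : R) :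
  fsum N (fun i => a * g i + b * h i) = a * fsum N g + b * fsum N h.
Proof.
  induction N as [|N IH]; simpl; [ring|].
  rewrite (IH (fun i => g (Fin.FS i)) (fun i => h (Fin.FS i))). ring.
Qed.

Lemma fsum_const N (c : R) : fsum N (fun _ => c) = INR N * c.
Proof.
  induction N as [|N IH]; [simpl; ring|].
  rewrite S_INR. simpl. rewrite IH. ring.
Qed.

Lemma fsum_le N (g h : Fin.t N -> R) :
  (forall i, g i <= h i) -> fsum N g <= fsum N h.
Proof.
  induction N as [|N IH]; simpl; intros H; [lra|].
  apply Rplus_le_compat; [apply H | apply IH; intros i; apply H].
Qed.

Lemma fsum_nonneg N (g : Fin.t N -> R) :
  (forall i, 0 <= g i) -> 0 <= fsum N g.
Proof.
  intros H. replace 0 with (fsum N (fun _ => 0)).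
  - now apply fsum_le.
  - rewrite fsum_const. ring.
Qed.

Lemma fsum_term_le N (g : Fin.t N -> R) (i : Fin.t N) :
  (forall j, 0 <= g j) -> g i <= fsum N g.
Proof.
  induction i as [N|N i IH]; simpl; intros H.
  - pose proof (fsum_nonneg N (fun j => g (Fin.FS j)) (fun j => H _)). lra.
  - pose proof (IH (fun j => g (Fin.FS j)) (fun j => H _)). specialize (H Fin.F1).
    simpl in *. lra.
Qed.

Lemma fsum_update N (i : Fin.t N) (a b : Fin.t N -> R) :
  fsum N (fun j => if Fin.eq_dec i j then a j else b j) = fsum N b + (a i - b i).
Proof.
  induction i as [N|N i IH]; cbn [fsum].
  - rewrite (fsum_ext N (fun j => if Fin.eq_dec Fin.F1 (Fin.FS j) then a (Fin.FS j)
                                  else b (Fin.FS j)) (fun j => b (Fin.FS j))).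
    + destruct (Fin.eq_dec Fin.F1 Fin.F1) as [e|n]; [lra | now elim n].
    + intros j. destruct (Fin.eq_dec Fin.F1 (Fin.FS j)) as [e|n]; [discriminate | easy].
  - rewrite (fsum_ext N (fun j => if Fin.eq_dec (Fin.FS i) (Fin.FS j) then a (Fin.FS j)
                                  else b (Fin.FS j))
               (fun j => if Fin.eq_dec i j then a (Fin.FS j) else b (Fin.FS j))).
    + rewrite (IH (fun j => a (Fin.FS j)) (fun j => b (Fin.FS j))).
      destruct (Fin.eq_dec (Fin.FS i) Fin.F1) as [e|n]; [discriminate | lra].
    + intros j.
      destruct (Fin.eq_dec i j) as [e|n], (Fin.eq_dec (Fin.FS i) (Fin.FS j)) as [e'|n']; try easy.
      * now elim n'; rewrite e.
      * now apply Fin.FS_inj in e'.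
Qed.

Lemma sqnorm_nonneg N (x : RN N) : 0 <= sqnorm x.
Proof. apply fsum_nonneg; intros i. apply pow2_ge_0. Qed.

Lemma sqnorm_shift N (x : RN N) (i : Fin.t N) (h : R) :
  sqnorm (shift x i h) = sqnorm x + 2 * x i * h + h ^ 2.
Proof.
  unfold sqnorm, shift.
  rewrite (fsum_ext N _ (fun j => if Fin.eq_dec i j then (x j + h) ^ 2 else x j ^ 2)).
  - rewrite (fsum_update N i (fun j => (x j + h) ^ 2) (fun j => x j ^ 2)). ring.
  - intros j. now destruct (Fin.eq_dec i j).
Qed.

Lemma shift_0 N (x : RN N) (i : Fin.t N) : shift x i 0 = x.
Proof.
  apply functional_extensionality; intros j. unfold shift.
  destruct (Fin.eq_dec i j); ring.
Qed.

(** Dividing by N + 1 instead of N covers N = 0 and leaves room for the strict inequality. *)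
Lemma sqdist_lt_of_close N (x y : RN N) (d : R) :
  0 < d -> (forall i, Rabs (y i - x i) < d / (INR N + 1)) -> sqdist y x < d ^ 2.
Proof.
  intros Hd H. pose proof (pos_INR N) as HN.
  set (e := d / (INR N + 1)) in *.
  assert (He : 0 < e) by (apply Rdiv_lt_0_compat; lra).
  assert (Hde : d = e * (INR N + 1)) by (unfold e; field; lra).
  apply Rle_lt_trans with (INR N * e ^ 2).
  - rewrite <- fsum_const. apply fsum_le; intros i.
    rewrite <- (pow2_abs (y i - x i)). apply pow_incr. specialize (H i).
    split; [apply Rabs_pos | lra].
  - rewrite Hde. nra.
Qed.

Lemma sqnorm_continuous N (x : RN N) (e : R) : 0 < e ->
  exists d, 0 < d /\ forall y : RN N, sqdist y x < d ^ 2 -> Rabs (sqnorm y - sqnorm x) < e.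
Proof.
  intros He. set (X := sqnorm x). assert (HX : 0 <= X) by apply sqnorm_nonneg.
  (* Young's inequality with weight [l] bounds the change of |x|^2 by l |x|^2 + (1 + 1/l) |y - x|^2;
     [l] and [q] make each term less than e / 2. The minimum with 1 below turns D < d^2 into D <
     q. *)
  set (l := e / (2 * (X + 1))).
  assert (Hl : 0 < l) by (apply Rdiv_lt_0_compat; lra).
  set (q := e / (2 * (1 + / l))).
  assert (Hil : 0 < / l) by now apply Rinv_0_lt_compat.
  assert (Hq : 0 < q) by (apply Rdiv_lt_0_compat; lra).
  exists (Rmin 1 q). split; [apply Rmin_pos; lra|]. intros y Hy.
  set (D := sqdist y x) in *.
  assert (HDq : D < q).
  { pose proof (Rmin_l 1 q). pose proof (Rmin_r 1 q).
    assert (0 < Rmin 1 q) by (apply Rmin_pos; lra). nra. }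
  assert (HlX : l * X < e / 2).
  { apply Rlt_le_trans with (l * (X + 1)); [nra|]. unfold l. right. field. lra. }
  assert (HlD : (1 + / l) * D < e / 2).
  { apply Rlt_le_trans with ((1 + / l) * q); [nra|].
    unfold q. right. field. lra. }
  (* Young's inequality for the cross term of [|y|^2 = |x|^2 + 2 x.(y-x) + |y-x|^2] *)
  assert (Hyoung : forall a b : R, Rabs (2 * a * b) <= l * a ^ 2 + / l * b ^ 2).
  { intros a b.
    assert (H1 : l * a ^ 2 + / l * b ^ 2 - 2 * a * b = / l * (l * a - b) ^ 2) by (field; lra).
    assert (H2 : l * a ^ 2 + / l * b ^ 2 + 2 * a * b = / l * (l * a + b) ^ 2) by (field; lra).
    pose proof (pow2_ge_0 (l * a - b)). pose proof (pow2_ge_0 (l * a + b)).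
    apply Rabs_le. split; nra. }
  assert (Hup : sqnorm y <= 1 * X + 1 * (l * X + (1 + / l) * D)).
  { unfold X, D, sqnorm, sqdist.
    rewrite <- !fsum_lin. apply fsum_le; intros i.
    specialize (Hyoung (x i) (y i - x i)). apply Rabs_le_between in Hyoung. nra. }
  assert (Hlo : 1 * X + (-1) * (l * X + (1 + / l) * D) <= sqnorm y).
  { unfold X, D, sqnorm, sqdist.
    rewrite <- !fsum_lin. apply fsum_le; intros i.
    specialize (Hyoung (x i) (y i - x i)). apply Rabs_le_between in Hyoung.
    pose proof (pow2_ge_0 (y i - x i)). nra. }
  apply Rabs_def1; lra.
Qed.

Lemma coord_le_of_sqnorm N (x : RN N) (B : R) (i : Fin.t N) :
  0 <= B -> sqnorm x <= B ^ 2 -> - B <= x i <= B.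
Proof.
  intros HB Hx.
  assert (x i ^ 2 <= B ^ 2).
  { apply Rle_trans with (sqnorm x); [|easy].
    apply (fsum_term_le N (fun j => x j ^ 2)). intros j. apply pow2_ge_0. }
  split; nra.
Qed.

(** Compactness of the cube [-B, B]^N: radii that serve locally are replaced by a single one. In the
    induction, the hypothesis for N makes the radius uniform over the slice with first coordinate t,
    and compactness of the interval then deals with t. *)
Lemma box_uniform_radius N (B : R) (Q : R -> RN N -> Prop) :
  (forall d d' y, 0 < d' <= d -> Q d y -> Q d' y) ->
  (forall x, (forall i, - B <= x i <= B) ->
     exists d, 0 < d /\ forall y, (forall i, Rabs (y i - x i) < d) -> Q d y) ->
  exists d, 0 < d /\ forall y, (forall i, - B <= y i <= B) -> Q d y.
Proof.
  revert Q. induction N as [|N IH]; intros Q Hmono Hloc.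
  - destruct (Hloc (fun i => Fin.case0 (fun _ => R) i)) as (d & Hd & H).
    { intros i. now apply Fin.case0. }
    exists d. split; [easy|]. intros y _. apply H. intros i. now apply Fin.case0.
  - set (cons := fun (t : R) (y : RN N) =>
      (fun i : Fin.t (S N) => Fin.caseS' i (fun _ => R) t y) : RN (S N)).
    assert (Hslab : forall t, exists d, 0 < d /\ (- B <= t <= B ->
      forall y : RN N, (forall i, - B <= y i <= B) ->
      forall t', Rabs (t' - t) < d -> Q d (cons t' y))).
    { intros t. destruct (classic (- B <= t <= B)) as [Ht|Ht].
      - destruct (IH (fun d y => forall t', Rabs (t' - t) < d -> Q d (cons t' y)))
          as (d & Hd & H).
        + intros d d' y Hd Hy t' Ht'. apply (Hmono d); [easy|]. apply Hy. lra.
        + intros x Hx. destruct (Hloc (cons t x)) as (d & Hd & H).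
          * intros i. now apply (Fin.caseS' i).
          * exists d. split; [easy|]. intros y Hy t' Ht'. apply H.
            intros i. now apply (Fin.caseS' i).
        + now exists d.
      - exists 1. split; [lra | easy]. }
    (* [compactness_value_1d] takes a gauge on the whole line, hence the default radius 1 outside
       [-B, B]. It concludes under a double negation, which is why [NNPP] appears below. *)
    set (delta := fun t =>
      let s := constructive_indefinite_description _ (Hslab t) in
      mkposreal (proj1_sig s) (proj1 (proj2_sig s))).
    destruct (compactness_value_1d (- B) B delta) as [d Hd].
    exists d. split; [apply cond_pos|]. intros y Hy.
    apply NNPP. intros HQ. apply (Hd (y Fin.F1) (Hy Fin.F1)). intros (t & Ht & Hyt & Hdt).
    apply HQ. apply (Hmono (delta t)); [split; [apply cond_pos | easy]|].
    replace y with (cons (y Fin.F1) (fun i => y (Fin.FS i))).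
    + apply (proj2 (proj2_sig (constructive_indefinite_description _ (Hslab t)))); easy.
    + apply functional_extensionality; intros i. now apply (Fin.caseS' i).
Qed.

(** * First touching point *)

Lemma deriv_nonneg_of_past (g : R -> R) (t l : R) :
  0 < t -> derivable_pt_lim g t l -> (forall s, 0 < s < t -> g s <= g t) -> 0 <= l.
Proof.
  intros Ht Hg Hmax. apply Rnot_lt_le; intros Hl.
  destruct (Hg (- l / 2)) as [d Hd]; [lra|].
  pose proof (cond_pos d) as Hd0.
  set (h := Rmin (d / 2) (t / 2)).
  assert (Hh : 0 < h) by (apply Rmin_pos; lra).
  assert (h <= d / 2) by apply Rmin_l. assert (h <= t / 2) by apply Rmin_r.
  specialize (Hd (- h)). rewrite Rabs_Ropp, Rabs_pos_eq in Hd by lra.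
  specialize (Hd ltac:(lra) ltac:(lra)). apply Rabs_lt_between in Hd.
  specialize (Hmax (t + - h) ltac:(lra)).
  assert (0 <= (g (t + - h) - g t) / - h).
  { replace ((g (t + - h) - g t) / - h) with ((g t - g (t + - h)) * / h) by (field; lra).
    apply Rmult_le_pos; [lra|]. left; now apply Rinv_0_lt_compat. }
  lra.
Qed.

Lemma deriv_zero_of_max (g : R -> R) (r l : R) :
  0 < r -> derivable_pt_lim g 0 l -> (forall h, Rabs h < r -> g h <= g 0) -> l = 0.
Proof.
  intros Hr Hg Hmax.
  assert (Hside : forall s, s = 1 \/ s = -1 -> s * l <= 0).
  { intros s Hs. apply Rnot_lt_le; intros Hl.
    destruct (Hg (s * l / 2)) as [d Hd]; [lra|].
    pose proof (cond_pos d) as Hd0.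
    set (h := Rmin (d / 2) (r / 2)).
    assert (Hh : 0 < h) by (apply Rmin_pos; lra).
    assert (h <= d / 2) by apply Rmin_l. assert (h <= r / 2) by apply Rmin_r.
    assert (Habs : Rabs (s * h) = h).
    { destruct Hs; subst s; rewrite ?Rmult_1_l; [now apply Rabs_pos_eq; lra|].
      replace (-1 * h) with (- h) by ring. rewrite Rabs_Ropp. apply Rabs_pos_eq; lra. }
    specialize (Hd (s * h)). rewrite Habs in Hd.
    specialize (Hd ltac:(destruct Hs; subst s; lra) ltac:(lra)). apply Rabs_lt_between in Hd.
    specialize (Hmax (s * h)). rewrite Habs in Hmax. specialize (Hmax ltac:(lra)).
    rewrite Rplus_0_l in Hd.
    assert (0 <= / h) by (left; now apply Rinv_0_lt_compat).
    destruct Hs; subst s.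
    - replace (1 * h) with h in * by ring.
      assert ((g h - g 0) / h <= 0) by (unfold Rdiv; nra). lra.
    - replace ((g (-1 * h) - g 0) / (-1 * h)) with (- ((g (-1 * h) - g 0) * / h)) in Hd
        by (field; lra).
      nra. }
  pose proof (Hside 1 (or_introl eq_refl)). pose proof (Hside (-1) (or_intror eq_refl)). lra.
Qed.

(** A positive [d2] would make [d1] positive just to the right of its zero at 0, and the mean value
    theorem would give g h > g 0. Only the derivative of [d1] at 0 enters, which is all that
    [is_second_partial] offers. *)
Lemma second_deriv_nonpos_of_max (g d1 : R -> R) (r d2 : R) :
  0 < r -> (forall h, Rabs h < r -> derivable_pt_lim g h (d1 h)) ->
  derivable_pt_lim d1 0 d2 -> (forall h, Rabs h < r -> g h <= g 0) -> d2 <= 0.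
Proof.
  intros Hr Hg Hd1 Hmax. apply Rnot_lt_le; intros Hd2.
  assert (H0 : d1 0 = 0).
  { apply (deriv_zero_of_max g r); [easy| |easy]. apply Hg. now rewrite Rabs_R0. }
  destruct (Hd1 (d2 / 2)) as [d Hd]; [lra|]. pose proof (cond_pos d) as Hd0.
  set (h := Rmin (d / 2) (r / 2)).
  assert (Hh : 0 < h) by (apply Rmin_pos; lra).
  assert (h <= d / 2) by apply Rmin_l. assert (h <= r / 2) by apply Rmin_r.
  destruct (MVT_cor2 g d1 0 h Hh) as (c & Hc & Hc').
  { intros c Hc. apply Hg. rewrite Rabs_pos_eq; lra. }
  specialize (Hmax h). rewrite Rabs_pos_eq in Hmax by lra. specialize (Hmax ltac:(lra)).
  specialize (Hd c). rewrite Rabs_pos_eq in Hd by lra.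
  specialize (Hd ltac:(lra) ltac:(lra)). rewrite Rplus_0_l, H0, Rminus_0_r in Hd.
  apply Rabs_lt_between in Hd.
  assert (Hpos : 0 < d1 c / c) by lra.
  assert (0 < d1 c).
  { replace (d1 c) with (d1 c / c * c) by (field; lra). apply Rmult_lt_0_compat; lra. }
  nra.
Qed.

(** The candidate time is the supremum m of the times up to which z < 0. If z were negative
    everywhere at time m, compactness of a cube containing the ball of radius B would extend
    negativity past m, or to all of (0, T]. Negativity is only assumed to be an open condition, so
    the conclusion is 0 <= z; [touch] recovers equality from differentiability in time. *)
Lemma first_touch N (z : R -> RN N -> R) (T B : R) :
  0 < T -> 0 <= B ->
  (forall x, exists d, 0 < d /\ forall s y, 0 < s < d -> sqdist y x < d ^ 2 -> z s y < 0) ->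
  (forall t x, 0 < t <= T -> z t x < 0 -> exists d, 0 < d /\
     forall s y, 0 < s -> Rabs (s - t) < d -> sqdist y x < d ^ 2 -> z s y < 0) ->
  (forall t x, 0 < t <= T -> B ^ 2 < sqnorm x -> z t x < 0) ->
  (exists t x, 0 < t <= T /\ 0 <= z t x) ->
  exists t x, 0 < t <= T /\ 0 <= z t x /\ forall s y, 0 < s < t -> z s y < 0.
Proof.
  intros HT HB Hinit Husc Hout (t0 & x0 & Ht0 & Hz0).
  set (S := fun t => 0 <= t <= T /\ forall s y, 0 < s <= t -> z s y < 0).
  destruct (completeness S) as [m [Hub Hlub]].
  { exists T. intros t [Ht _]. apply Ht. }
  { exists 0. split; [lra|]. intros s y Hs. lra. }
  assert (Hm0 : 0 <= m). { apply Hub. split; [lra|]. intros s y Hs. lra. }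
  assert (HmT : m <= T). { apply Hlub. intros t [Ht _]. apply Ht. }
  assert (Hbefore : forall s y, 0 < s < m -> z s y < 0).
  { intros s y Hs. apply NNPP; intros Hn.
    assert (m <= s); [|lra]. apply Hlub. intros t [Ht Ht'].
    apply Rnot_lt_le; intros Hst. apply Hn. apply Ht'. lra. }
  destruct (classic (exists x, 0 < m /\ 0 <= z m x)) as [(x & Hm & Hx)|Hno].
  { exists m, x. easy. }
  exfalso.
  assert (Hat : forall y, 0 < m -> z m y < 0).
  { intros y Hm. apply Rnot_le_lt; intros Hy. apply Hno. now exists y. }
  destruct (box_uniform_radius N B
    (fun d y => forall s, 0 < s -> Rabs (s - m) < d -> z s y < 0)) as (d & Hd & HQ).
  - intros d d' y Hd H s Hs Hsm. apply H; lra.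
  - intros x _. assert (exists d, 0 < d /\
      forall s y, 0 < s -> Rabs (s - m) < d -> sqdist y x < d ^ 2 -> z s y < 0)
      as (d & Hd & H).
    { destruct (Rle_lt_or_eq_dec 0 m Hm0) as [Hm|Hm].
      - apply Husc; [lra | now apply Hat].
      - destruct (Hinit x) as (d & Hd & H). exists d. split; [easy|].
        intros s y Hs Hsm. apply H. rewrite <- Hm, Rminus_0_r, Rabs_pos_eq in Hsm; lra. }
    pose proof (pos_INR N).
    assert (Hle : d / (INR N + 1) <= d).
    { apply Rle_div_l; nra. }
    exists (d / (INR N + 1)). split; [apply Rdiv_lt_0_compat; lra|].
    intros y Hy s Hs Hsm. apply H; [easy | lra |]. now apply sqdist_lt_of_close.
  - set (t1 := Rmin (m + d / 2) T).
    assert (Ht1 : forall s y, 0 < s <= t1 -> z s y < 0).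
    { intros s y Hs.
      assert (t1 <= m + d / 2) by apply Rmin_l. assert (t1 <= T) by apply Rmin_r.
      destruct (Rlt_le_dec s m) as [Hsm|Hsm]; [apply Hbefore; lra|].
      destruct (Rlt_le_dec (B ^ 2) (sqnorm y)) as [Hy|Hy]; [apply Hout; [lra|easy]|].
      apply HQ; [|easy|].
      - intros i. now apply coord_le_of_sqnorm.
      - rewrite Rabs_pos_eq; lra. }
    assert (Hle : t1 <= m).
    { apply Hub. split; [|easy]. split; [|apply Rmin_r]. apply Rmin_glb; lra. }
    unfold t1, Rmin in *. destruct (Rle_dec (m + d / 2) T); [lra|].
    pose proof (Ht1 t0 x0 ltac:(lra)). lra.
Qed.

Lemma derivable_pt_lim_affine (k c h : R) : derivable_pt_lim (fun h => k * h + c) h k.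
Proof.
  apply is_derive_Reals. auto_derive; [easy | ring].
Qed.

(* Radial functions are written in terms of [rho = |x|^2]: the Laplacian of [phi (|x|^2)]
   is [2 N phi' + 4 rho phi'']. *)
Lemma touch N (phi : R -> R -> R) (v : R -> RN N -> R) (t : R) (x : RN N)
    (phit vt r d2 : R) (d1 : R -> R) (e : Fin.t N -> R) :
  0 < t ->
  (forall s y, 0 < s < t -> phi s (sqnorm y) - v s y < 0) ->
  0 <= phi t (sqnorm x) - v t x ->
  (forall y, 0 <= phi t (sqnorm y) - v t y ->
     exists l, derivable_pt_lim (fun s => phi s (sqnorm y)) t l) ->
  (forall y, exists l, derivable_pt_lim (fun s => v s y) t l) ->
  derivable_pt_lim (fun s => phi s (sqnorm x)) t phit ->
  derivable_pt_lim (fun s => v s x) t vt ->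
  0 < r ->
  (forall rho, Rabs (rho - sqnorm x) < r -> derivable_pt_lim (phi t) rho (d1 rho)) ->
  derivable_pt_lim d1 (sqnorm x) d2 ->
  (forall i, is_second_partial (v t) x i (e i)) ->
  phi t (sqnorm x) = v t x /\
  vt - fsum N e <= phit - (2 * INR N * d1 (sqnorm x) + 4 * sqnorm x * d2).
Proof.
  intros Ht Hpast Hx Hphi Hv Hphit Hvt Hr Hd1 Hd2 He.
  (* The past only concerns times before t. Continuity in time at fixed y carries the inequality to
     t, so that phi - v has a spatial maximum at x, of value 0. Differentiability of phi in time is
     asked only where phi >= v, because a subsolution is smooth only where it is positive. *)
  assert (Hmax : forall y, phi t (sqnorm y) - v t y <= 0).
  { intros y. apply Rnot_lt_le; intros Hy.
    destruct (Hphi y) as [l1 Hl1]; [lra|]. destruct (Hv y) as [l2 Hl2].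
    pose proof (derivable_pt_lim_minus _ _ _ _ _ Hl1 Hl2) as Hl.
    assert (Hc : continuity_pt (fun s => phi s (sqnorm y) - v s y) t).
    { apply derivable_continuous_pt. exists (l1 - l2). exact Hl. }
    destruct (Hc _ Hy) as (a & Ha & H).
    set (h := Rmin (a / 2) (t / 2)).
    assert (Hh : 0 < h) by (apply Rmin_pos; lra).
    assert (h <= a / 2) by apply Rmin_l. assert (h <= t / 2) by apply Rmin_r.
    specialize (H (t - h)). specialize (Hpast (t - h) y ltac:(lra)).
    simpl in H. unfold Rdist in H.
    assert (Hlt : Rabs (phi (t - h) (sqnorm y) - v (t - h) y - (phi t (sqnorm y) - v t y)) <
            phi t (sqnorm y) - v t y).
    { apply H. split; [split; [easy | lra]|].
      replace (t - h - t) with (- h) by ring. rewrite Rabs_Ropp, Rabs_pos_eq; lra. }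
    apply Rabs_lt_between in Hlt. lra. }
  assert (Hx0 : phi t (sqnorm x) - v t x = 0) by (specialize (Hmax x); lra).
  split; [lra|].
  assert (Htime : 0 <= phit - vt).
  { apply (deriv_nonneg_of_past (fun s => phi s (sqnorm x) - v s x) t); [easy| |].
    - exact (derivable_pt_lim_minus _ _ _ _ _ Hphit Hvt).
    - intros s Hs. specialize (Hpast s x Hs). lra. }
  (* Along the i-th axis rho is the quadratic [rh], and the second derivative of phi (rho) at h = 0
     is 2 phi' + 4 x_i^2 phi''. The factor 1 gives the left side the shape needed by [fsum_lin]. *)
  assert (Hspace : forall i, 2 * d1 (sqnorm x) * 1 + 4 * d2 * (x i ^ 2) <= e i).
  { intros i. destruct (He i) as (dv & Hdv & Hdv2).
    set (rh := fun h => sqnorm x + 2 * x i * h + h ^ 2).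
    set (g := fun h => phi t (rh h) - v t (shift x i h)).
    assert (Hrh : forall h, derivable_pt_lim rh h (2 * x i + 2 * h)).
    { intros h. apply is_derive_Reals. unfold rh. auto_derive; [easy | ring]. }
    assert (Hrh0 : rh 0 = sqnorm x) by (unfold rh; ring).
    assert (Hcont : continuity_pt rh 0).
    { apply derivable_continuous_pt. exists (2 * x i + 2 * 0). apply Hrh. }
    destruct (Hcont r Hr) as (a & Ha & Hnear).
    assert (Hnear' : forall h, Rabs h < a -> Rabs (rh h - sqnorm x) < r).
    { intros h Hh. rewrite <- Hrh0. destruct (Req_dec h 0) as [->|Hn].
      - now rewrite Rminus_diag, Rabs_R0.
      - apply Hnear. split; [split; [easy | lra]|]. simpl. unfold Rdist.
        now rewrite Rminus_0_r. }
    set (g1 := fun h => d1 (rh h) * (2 * h + 2 * x i) - dv h).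
    assert (Hg2 : d2 * (2 * x i + 2 * 0) * (2 * 0 + 2 * x i) + d1 (rh 0) * 2 - e i <= 0).
    { apply (second_deriv_nonpos_of_max g g1 a); [easy | | |].
      - intros h Hh. unfold g, g1. apply derivable_pt_lim_minus.
        + rewrite (Rplus_comm (2 * h)).
          apply (derivable_pt_lim_comp rh (phi t)); [apply Hrh|].
          now apply Hd1, Hnear'.
        + assert (Hs : forall k, shift (shift x i h) i k = shift x i (h + k)).
          { intros k. apply functional_extensionality; intros j. unfold shift.
            destruct (Fin.eq_dec i j); ring. }
          specialize (Hdv h). unfold is_partial in Hdv.
          intros eps Heps. destruct (Hdv eps Heps) as [dl Hdl]. exists dl.
          intros k Hk Hk'. specialize (Hdl k Hk Hk').
          rewrite !Hs, Rplus_0_l, Rplus_0_r in Hdl. exact Hdl.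
      - unfold g1. apply derivable_pt_lim_minus; [|easy].
        apply (derivable_pt_lim_mult (fun h => d1 (rh h)) (fun h => 2 * h + 2 * x i)).
        + apply (derivable_pt_lim_comp rh d1); [apply Hrh | now rewrite Hrh0].
        + apply derivable_pt_lim_affine.
      - intros h _. unfold g. rewrite shift_0, Hrh0, Hx0.
        unfold rh. rewrite <- sqnorm_shift. apply Hmax. }
    rewrite Hrh0 in Hg2. nra. }
  apply fsum_le in Hspace.
  rewrite (fsum_lin N (fun _ => 1) (fun i => x i ^ 2)), fsum_const in Hspace.
  fold (sqnorm x) in Hspace. lra.
Qed.

(** * Bounds 0 <= u <= 1 and comparison *)

Lemma radial_continuous N (phi : R -> R -> R) (t : R) (x : RN N) (e : R) :
  continuity_2d_pt phi t (sqnorm x) -> 0 < e ->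
  exists d, 0 < d /\ forall s (y : RN N), Rabs (s - t) < d -> sqdist y x < d ^ 2 ->
    Rabs (phi s (sqnorm y) - phi t (sqnorm x)) < e.
Proof.
  intros Hc He. destruct (Hc (mkposreal e He)) as [d1 H1]. simpl in H1.
  destruct (sqnorm_continuous N x d1 (cond_pos d1)) as (d2 & Hd2 & H2).
  pose proof (cond_pos d1).
  exists (Rmin d1 d2). split; [now apply Rmin_pos|]. intros s y Hs Hy.
  pose proof (Rmin_l d1 d2). pose proof (Rmin_r d1 d2).
  assert (0 < Rmin d1 d2) by now apply Rmin_pos.
  apply H1; [lra|]. apply H2. nra.
Qed.

Lemma sqdist_lt_mono N (x y : RN N) (d d' : R) :
  0 < d <= d' -> sqdist y x < d ^ 2 -> sqdist y x < d' ^ 2.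
Proof. intros Hd H. nra. Qed.

Lemma exp_le_mono (a b : R) : a <= b -> exp a <= exp b.
Proof.
  intros [H|H]; [left; now apply exp_increasing | rewrite H; lra].
Qed.

(* For suitable [C], [a], [K] this is a supersolution of the heat equation on [|x| <= B]. It
   equals [A] on the sphere [|x|^2 = l] at time [0], and for [t > 0] it tends to [0] with [q]. *)
Definition sphere_barrier (A C a q K l t rho : R) : R :=
  A * exp (C * t + a * (ln q - ln (t + q)) - (rho - l) ^ 2 / (K * (t + q))).

Lemma sphere_barrier_derivs (A C a q K l t : R) :
  0 < q -> 0 < K -> 0 < t ->
  let tau := t + q in
  let E rho := sphere_barrier A C a q K l t rho in
  (forall rho, derivable_pt_lim (fun s => sphere_barrier A C a q K l s rho) t
     (E rho * (C - a / tau + (rho - l) ^ 2 / (K * tau ^ 2)))) /\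
  (forall rho, derivable_pt_lim (sphere_barrier A C a q K l t) rho
     (E rho * (- 2 * (rho - l) / (K * tau)))) /\
  (forall rho, derivable_pt_lim (fun rho => E rho * (- 2 * (rho - l) / (K * tau))) rho
     (E rho * (4 * (rho - l) ^ 2 / (K * tau) ^ 2 - 2 / (K * tau)))).
Proof.
  intros Hq HK Ht tau E. unfold E, tau, sphere_barrier.
  repeat split; intros rho; apply is_derive_Reals; auto_derive;
    try (repeat split; try lra; apply Rgt_not_eq; nra);
    simpl; unfold Rminus, Rdiv;
    match goal with |- context [exp ?y] => generalize (exp y); intros ex end;
    field; repeat split; lra.
Qed.

(** A completed square in g = (rho - l) / tau. The value a = 8 l / K combines with the Laplacian
    term 8 rho / (K tau) into 8 g / K, C supplies the constant term of the square, and K = 32 B^2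
    keeps the remaining coefficient of g^2 nonnegative on rho <= B^2. *)
Lemma sphere_barrier_supersolution (A q K B l n t rho : R) :
  0 < A -> 0 < q -> 0 < t -> 0 < B -> 0 <= n -> 0 <= rho <= B ^ 2 -> K = 32 * B ^ 2 ->
  let tau := t + q in
  let E := sphere_barrier A ((8 + 4 * n) ^ 2 / (2 * K)) (8 * l / K) q K l t rho in
  0 <= E * ((8 + 4 * n) ^ 2 / (2 * K) - 8 * l / K / tau + (rho - l) ^ 2 / (K * tau ^ 2))
       - (2 * n * (E * (- 2 * (rho - l) / (K * tau)))
          + 4 * rho * (E * (4 * (rho - l) ^ 2 / (K * tau) ^ 2 - 2 / (K * tau)))).
Proof.
  intros HA Hq Ht HB Hn Hrho HK tau E.
  assert (HE : 0 < E) by (apply Rmult_lt_0_compat; [easy | apply exp_pos]).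
  assert (HK0 : 0 < K) by nra. assert (Htau : 0 < tau) by (unfold tau; lra).
  set (g := (rho - l) / tau).
  match goal with |- 0 <= ?X => replace X with
    (E * (/ (2 * K)) * ((g + (8 + 4 * n)) ^ 2 + g ^ 2 * ((K - 32 * rho) / K))) end.
  - assert (0 < / (2 * K)) by (apply Rinv_0_lt_compat; lra).
    apply Rmult_le_pos; [nra|].
    assert (0 <= (K - 32 * rho) / K).
    { apply Rmult_le_pos; [lra|]. left; now apply Rinv_0_lt_compat. }
    pose proof (pow2_ge_0 (g + (8 + 4 * n))). pose proof (pow2_ge_0 g). nra.
  - unfold g. field. lra.
Qed.

Lemma continuity_2d_exp (g : R -> R -> R) (x y : R) :
  continuity_2d_pt g x y -> continuity_2d_pt (fun u v => exp (g u v)) x y.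
Proof.
  apply (continuity_1d_2d_pt_comp exp). apply derivable_continuous_pt, derivable_pt_exp.
Qed.

Lemma continuity_2d_ln (g : R -> R -> R) (x y : R) :
  0 < g x y -> continuity_2d_pt g x y -> continuity_2d_pt (fun u v => ln (g u v)) x y.
Proof.
  intros Hg. apply (continuity_1d_2d_pt_comp ln).
  apply derivable_continuous_pt. exists (/ g x y). now apply derivable_pt_lim_ln.
Qed.

Ltac cont2d :=
  repeat first
    [ apply continuity_2d_pt_const | apply continuity_2d_pt_id1 | apply continuity_2d_pt_id2
    | apply continuity_2d_pt_plus | apply continuity_2d_pt_minus | apply continuity_2d_pt_opp
    | apply continuity_2d_pt_mult | apply continuity_2d_exp ].

Lemma sphere_barrier_continuous (A C a q K l t rho : R) :
  0 < q -> 0 < K -> 0 <= t -> continuity_2d_pt (sphere_barrier A C a q K l) t rho.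
Proof.
  intros Hq HK Ht. unfold sphere_barrier, Rdiv, pow. cont2d.
  - apply continuity_2d_ln; [lra|]. cont2d.
  - apply continuity_2d_pt_inv; [cont2d|]. apply Rgt_not_eq. nra.
Qed.

(* No initial information is needed on the sphere [|x| = L]: it is thin enough for its
   contribution to vanish, as measured by [sphere_barrier]. *)
Lemma heat_supersolution_nonneg N (v : R -> RN N -> R) (M L : R) :
  0 < L ->
  (forall t x, 0 < t -> - M <= v t x) ->
  (forall t x, 0 < t -> forall e, 0 < e -> exists d, 0 < d /\
     forall s y, 0 < s -> Rabs (s - t) < d -> sqdist y x < d ^ 2 -> Rabs (v s y - v t x) < e) ->
  (forall x, sqnorm x <> L ^ 2 -> forall e, 0 < e -> exists d, 0 < d /\
     forall s y, 0 < s < d -> sqdist y x < d ^ 2 -> - e < v s y) ->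
  (forall t x, 0 < t -> exists (vt : R) (e : Fin.t N -> R),
     derivable_pt_lim (fun s => v s x) t vt /\
     (forall i, is_second_partial (v t) x i (e i)) /\
     (v t x < 0 -> fsum N e <= vt)) ->
  forall t x, 0 < t -> 0 <= v t x.
Proof.
  intros HL HM Hcont Hinit Hpde t0 x0 Ht0. apply Rnot_lt_le; intros Hneg.
  pose proof (pos_INR N) as HN. set (n := INR N) in *.
  set (A := Rmax 0 M + 1).
  assert (HA : 0 < A /\ M < A).
  { unfold A. pose proof (Rmax_l 0 M). pose proof (Rmax_r 0 M). lra. }
  (* The negativity of v at (t0, x0) is split in two halves: [dl] is chosen so that the growing term
     dl W equals [eta], and the barrier gets the other half. Beyond radius [B] the growing term
     exceeds A > M, which confines touching points to a ball. *)
  set (eta := - v t0 x0 / 2). assert (Heta : 0 < eta) by (unfold eta; lra).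
  set (W := 1 + sqnorm x0 + (2 * n + 1) * t0).
  assert (HW : 0 < W). { pose proof (sqnorm_nonneg N x0). unfold W. nra. }
  set (dl := eta / W). assert (Hdl : 0 < dl) by now apply Rdiv_lt_0_compat.
  set (B := 1 + A / dl).
  assert (HB : 1 < B). { unfold B. pose proof (Rdiv_lt_0_compat A dl). lra. }
  assert (HdlB : A < dl * B ^ 2).
  { assert (dl * B = dl + A) by (unfold B; field; lra). nra. }
  set (K := 32 * B ^ 2). assert (HK : 0 < K) by (unfold K; nra).
  set (l := L ^ 2). assert (Hl : 0 < l) by (unfold l; nra).
  set (C := (8 + 4 * n) ^ 2 / (2 * K)).
  set (a := 8 * l / K). assert (Ha : 0 < a) by (apply Rdiv_lt_0_compat; lra).
  (* [q] solves A exp (C t0) (q / t0)^a = eta, which brings the barrier below [eta] at time t0. *)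
  set (q := exp (ln t0 + (ln (eta / A) - C * t0) / a)).
  assert (Hq : 0 < q) by apply exp_pos.
  set (S := sphere_barrier A C a q K l).
  assert (HSpos : forall s rho, 0 < S s rho).
  { intros s rho. apply Rmult_lt_0_compat; [apply HA | apply exp_pos]. }
  assert (HS0 : S t0 (sqnorm x0) <= eta).
  { unfold S, sphere_barrier. replace eta with (A * exp (ln (eta / A))).
    - apply Rmult_le_compat_l; [lra|]. apply exp_le_mono.
      assert (0 <= (sqnorm x0 - l) ^ 2 / (K * (t0 + q))).
      { apply Rmult_le_pos; [apply pow2_ge_0|]. left. apply Rinv_0_lt_compat. nra. }
      assert (ln t0 <= ln (t0 + q)) by (apply ln_le; lra).
      replace (ln q) with (ln t0 + (ln (eta / A) - C * t0) / a) by (unfold q; now rewrite ln_exp).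
      replace (C * t0 + a * (ln t0 + (ln (eta / A) - C * t0) / a - ln (t0 + q)) -
        (sqnorm x0 - l) ^ 2 / (K * (t0 + q))) with (ln (eta / A) - a * (ln (t0 + q) - ln t0) -
        (sqnorm x0 - l) ^ 2 / (K * (t0 + q))) by (field; split; nra).
      nra.
    - rewrite exp_ln; [field; lra|]. apply Rdiv_lt_0_compat; lra. }
  (* The Laplacian of rho is 2 n, so the slope 2 n + 1 in time makes the growing term a strict
     supersolution, with excess [dl]. This strictness gives the contradiction at the touching
     point. *)
  set (phi := fun s rho => - (dl * (1 + rho + (2 * n + 1) * s) + S s rho)).
  assert (Hphic : forall t rho, 0 <= t -> continuity_2d_pt phi t rho).
  { intros t rho Ht. unfold phi.
    apply continuity_2d_pt_opp, continuity_2d_pt_plus; [cont2d|].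
    now apply sphere_barrier_continuous. }
  set (z := fun s (y : RN N) => phi s (sqnorm y) - v s y).
  assert (Hlin : forall s (y : RN N), 0 < s ->
    dl * (1 + sqnorm y) <= dl * (1 + sqnorm y + (2 * n + 1) * s)).
  { intros s y Hs. apply Rmult_le_compat_l; nra. }
  destruct (first_touch N z t0 B) as (t & x & Ht & Hx & Hpast); try lra.
  - intros x. destruct (classic (sqnorm x = l)) as [Hxl|Hxl].
    (* On the sphere the barrier equals A > M, so the global lower bound on v suffices; off the
       sphere the hypothesis on the initial values does. *)
    + destruct (radial_continuous N S 0 x (A - M)) as (d & Hd & H); [| lra |].
      { apply sphere_barrier_continuous; lra. }
      assert (HSx : S 0 (sqnorm x) = A).
      { unfold S, sphere_barrier. rewrite Hxl.
        replace (C * 0 + a * (ln q - ln (0 + q)) - (l - l) ^ 2 / (K * (0 + q))) with 0.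
        - rewrite exp_0. ring.
        - rewrite Rplus_0_l. field. lra. }
      exists d. split; [easy|]. intros s y Hs Hy.
      specialize (H s y). rewrite Rminus_0_r, Rabs_pos_eq in H by lra.
      specialize (H ltac:(lra) Hy). rewrite HSx in H. apply Rabs_lt_between in H.
      specialize (HM s y ltac:(lra)). specialize (Hlin s y ltac:(lra)).
      pose proof (sqnorm_nonneg N y). unfold z, phi. nra.
    + destruct (Hinit x Hxl dl Hdl) as (d & Hd & H). exists d. split; [easy|].
      intros s y Hs Hy. specialize (H s y Hs Hy). specialize (Hlin s y ltac:(lra)).
      pose proof (sqnorm_nonneg N y). specialize (HSpos s (sqnorm y)). unfold z, phi. nra.
  - intros t x Ht Hx. set (e := - z t x / 2).
    assert (He : 0 < e) by (unfold e; lra).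
    destruct (radial_continuous N phi t x e) as (d1 & Hd1 & H1); [| easy |].
    { apply Hphic. lra. }
    destruct (Hcont t x ltac:(lra) e He) as (d2 & Hd2 & H2).
    exists (Rmin d1 d2). assert (0 < Rmin d1 d2) by now apply Rmin_pos.
    pose proof (Rmin_l d1 d2). pose proof (Rmin_r d1 d2).
    split; [easy|]. intros s y Hs Hst Hy.
    specialize (H1 s y ltac:(lra) (sqdist_lt_mono N x y (Rmin d1 d2) d1 ltac:(lra) Hy)).
    specialize (H2 s y Hs ltac:(lra) (sqdist_lt_mono N x y (Rmin d1 d2) d2 ltac:(lra) Hy)).
    apply Rabs_lt_between in H1. apply Rabs_lt_between in H2.
    unfold e, z in *. lra.
  - intros t x Ht Hx. specialize (HM t x ltac:(lra)). specialize (Hlin t x ltac:(lra)).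
    specialize (HSpos t (sqnorm x)). unfold z, phi. nra.
  - exists t0, x0. split; [lra|]. unfold z, phi. fold W.
    assert (dl * W = eta) by (unfold dl; field; lra). unfold eta in *. lra.
  - assert (Hrho : sqnorm x <= B ^ 2).
    { apply Rnot_lt_le; intros Hlt. specialize (HM t x ltac:(lra)).
      specialize (Hlin t x ltac:(lra)). specialize (HSpos t (sqnorm x)).
      unfold z, phi in Hx. nra. }
    pose proof (sqnorm_nonneg N x) as Hrho0.
    destruct (Hpde t x ltac:(lra)) as (vt & e & Hvt & He & Hle).
    assert (Hvneg : v t x < 0).
    { specialize (Hlin t x ltac:(lra)). specialize (HSpos t (sqnorm x)).
      unfold z, phi in Hx. nra. }
    specialize (Hle Hvneg).
    destruct (sphere_barrier_derivs A C a q K l t Hq HK ltac:(lra)) as (DS & D1 & D2).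
    fold S in DS, D1, D2.
    set (phit := fun rho =>
      - (dl * (2 * n + 1) + S t rho * (C - a / (t + q) + (rho - l) ^ 2 / (K * (t + q) ^ 2)))).
    assert (Hphit : forall rho, derivable_pt_lim (fun s => phi s rho) t (phit rho)).
    { intros rho. apply derivable_pt_lim_opp. apply derivable_pt_lim_plus; [|apply DS].
      apply is_derive_Reals. auto_derive; [easy | ring]. }
    pose proof (touch N phi v t x (phit (sqnorm x)) vt 1
      (- (S t (sqnorm x) * (4 * (sqnorm x - l) ^ 2 / (K * (t + q)) ^ 2 - 2 / (K * (t + q)))))
      (fun rho => - (dl + S t rho * (- 2 * (rho - l) / (K * (t + q))))) e
      ltac:(lra) Hpast Hx) as Htouch.
    specialize (Htouch (fun y _ => ex_intro _ _ (Hphit (sqnorm y)))).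
    assert (Hvd : forall y, exists l, derivable_pt_lim (fun s => v s y) t l).
    { intros y. destruct (Hpde t y ltac:(lra)) as (l' & _ & H & _). now exists l'. }
    specialize (Htouch Hvd (Hphit _) Hvt Rlt_0_1).
    assert (Hd1 : forall rho, derivable_pt_lim (phi t) rho
      (- (dl + S t rho * (- 2 * (rho - l) / (K * (t + q)))))).
    { intros rho. apply derivable_pt_lim_opp. apply derivable_pt_lim_plus; [|apply D1].
      apply is_derive_Reals. auto_derive; [easy | ring]. }
    specialize (Htouch (fun rho _ => Hd1 rho)).
    assert (Hd2 : derivable_pt_lim
      (fun rho => - (dl + S t rho * (- 2 * (rho - l) / (K * (t + q))))) (sqnorm x)
      (- (S t (sqnorm x) * (4 * (sqnorm x - l) ^ 2 / (K * (t + q)) ^ 2 - 2 / (K * (t + q)))))).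
    { apply derivable_pt_lim_opp.
      rewrite <- (Rplus_0_l (S t (sqnorm x) * (_ - _))).
      apply derivable_pt_lim_plus; [apply derivable_pt_lim_const | apply D2]. }
    destruct (Htouch Hd2 He) as [_ Hheat].
    pose proof (sphere_barrier_supersolution A q K B l n t (sqnorm x) (proj1 HA) Hq
      ltac:(lra) ltac:(lra) HN (conj Hrho0 Hrho) eq_refl) as Hsup.
    fold C a in Hsup. cbv zeta in Hsup. fold S in Hsup. fold n in Hheat. unfold phit in Hheat. nra.
Qed.

(** The properties that survive a translation in time, so that each stage can restart from a later
    state. The initial condition is kept apart in [starts_above]. *)
Definition nonneg_solution (N : nat) (f : R -> R) (u : R -> RN N -> R) : Prop :=
  (forall t x, 0 < t -> 0 <= u t x) /\
  (forall t x, 0 < t -> forall e, 0 < e -> exists d, 0 < d /\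
     forall s y, 0 < s -> Rabs (s - t) < d -> sqdist y x < d ^ 2 ->
       Rabs (u s y - u t x) < e) /\
  (forall t x, 0 < t -> exists (ut : R) (e : Fin.t N -> R),
     derivable_pt_lim (fun s => u s x) t ut /\
     (forall i, is_second_partial (u t) x i (e i)) /\
     ut = fsum N e + f (u t x)).

(** A lower limit as (s, y) tends to (0, x) with s > 0. It covers both the initial data of the
    problem and a positive time at which the solution is restarted, and asks nothing on the sphere
    itself. *)
Definition starts_above {N : nat} (u : R -> RN N -> R) (g l : R) : Prop :=
  forall x, sqnorm x < l -> forall e, 0 < e -> exists d, 0 < d /\
    forall s y, 0 < s < d -> sqdist y x < d ^ 2 -> g - e < u s y.

Lemma ball_data_locally_constant N (eps L : R) (x : RN N) :
  sqnorm x <> L ^ 2 ->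
  exists d, 0 < d /\ forall y : RN N, sqdist y x < d ^ 2 ->
    ball_data eps L y = ball_data eps L x.
Proof.
  intros Hx.
  destruct (sqnorm_continuous N x (Rabs (sqnorm x - L ^ 2))) as (d & Hd & H).
  { apply Rabs_pos_lt. lra. }
  exists d. split; [easy|]. intros y Hy. specialize (H y Hy). unfold ball_data.
  apply Rabs_lt_between in H.
  destruct (Rlt_dec (sqnorm y) (L ^ 2)) as [H1|H1], (Rlt_dec (sqnorm x) (L ^ 2)) as [H2|H2];
    try easy.
  - rewrite Rabs_pos_eq in H; lra.
  - rewrite Rabs_left in H; lra.
Qed.

Lemma solution_initial_limit N f (eps L : R) u (x : RN N) :
  is_solution N f (ball_data eps L) u -> sqnorm x <> L ^ 2 ->
  forall e, 0 < e -> exists d, 0 < d /\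
    forall s y, 0 < s < d -> sqdist y x < d ^ 2 -> Rabs (u s y - ball_data eps L x) < e.
Proof.
  intros (_ & _ & _ & Hinit & _) Hx. apply Hinit. intros e He.
  destruct (ball_data_locally_constant N eps L x Hx) as (d & Hd & H).
  exists d. split; [easy|]. intros y Hy. rewrite H by easy. now rewrite Rminus_diag, Rabs_R0.
Qed.

Lemma is_second_partial_one_minus N (g : RN N -> R) x i d2 :
  is_second_partial g x i d2 -> is_second_partial (fun y => 1 - g y) x i (- d2).
Proof.
  intros (d1 & H1 & H2). exists (fun h => - d1 h). split.
  - intros h. unfold is_partial. replace (- d1 h) with (0 - d1 h) by ring.
    apply (derivable_pt_lim_minus (fun _ => 1)); [apply derivable_pt_lim_const | apply H1].
  - now apply derivable_pt_lim_opp.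
Qed.

(** Where u < 0, or u > 1, the reaction vanishes, so u, or 1 - u, satisfies the heat equation
    exactly where [heat_supersolution_nonneg] asks for it. *)
Lemma solution_bounds N f (eps L : R) u :
  (forall v, v <= 0 -> f v = 0) -> (forall v, 1 <= v -> f v = 0) ->
  0 < L -> 0 <= eps <= 1 -> is_solution N f (ball_data eps L) u ->
  forall t x, 0 < t -> 0 <= u t x <= 1.
Proof.
  intros Hf0 Hf1 HL Heps Hu.
  pose proof (fun x => solution_initial_limit N f eps L u x Hu) as Hinit.
  destruct Hu as (_ & (M & HM) & Hcont & _ & Hpde).
  assert (Hball : forall x : RN N, 0 <= ball_data eps L x <= 1).
  { intros x. unfold ball_data. destruct (Rlt_dec (sqnorm x) (L ^ 2)); lra. }
  intros t x Ht. split.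
  - revert t x Ht. apply (heat_supersolution_nonneg N u M L HL); [| easy | |].
    + intros t x Ht. specialize (HM t x Ht). apply Rabs_le_between in HM. lra.
    + intros x Hx e He. destruct (Hinit x Hx e He) as (d & Hd & H).
      exists d. split; [easy|]. intros s y Hs Hy. specialize (H s y Hs Hy).
      apply Rabs_lt_between in H. specialize (Hball x). lra.
    + intros t x Ht. destruct (Hpde t x Ht) as (ut & e & H1 & H2 & H3).
      exists ut, e. repeat split; try easy. intros Hneg. rewrite H3, Hf0; lra.
  - enough (0 <= 1 - u t x) by lra.
    revert t x Ht.
    apply (heat_supersolution_nonneg N (fun t x => 1 - u t x) (M + 1) L HL).
    + intros t x Ht. specialize (HM t x Ht). apply Rabs_le_between in HM. lra.
    + intros t x Ht e He. destruct (Hcont t x Ht e He) as (d & Hd & H).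
      exists d. split; [easy|]. intros s y Hs Hst Hy.
      rewrite <- Rabs_Ropp.
      replace (- (1 - u s y - (1 - u t x))) with (u s y - u t x) by ring. now apply H.
    + intros x Hx e He. destruct (Hinit x Hx e He) as (d & Hd & H).
      exists d. split; [easy|]. intros s y Hs Hy. specialize (H s y Hs Hy).
      apply Rabs_lt_between in H. specialize (Hball x). lra.
    + intros t x Ht. destruct (Hpde t x Ht) as (ut & e & H1 & H2 & H3).
      exists (- ut), (fun i => - e i). repeat split.
      * replace (- ut) with (0 - ut) by ring.
        apply (derivable_pt_lim_minus (fun _ => 1)); [apply derivable_pt_lim_const | easy].
      * intros i. now apply is_second_partial_one_minus.
      * intros Hneg. rewrite H3, Hf1 by lra.
        rewrite (fsum_ext N (fun i => - e i) (fun i => (-1) * e i + 0 * e i)).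
        -- rewrite fsum_lin. lra.
        -- intros i. ring.
Qed.

Lemma solution_nonneg_solution N f (eps L : R) u :
  (forall v, v <= 0 -> f v = 0) -> (forall v, 1 <= v -> f v = 0) ->
  0 < L -> 0 <= eps <= 1 -> is_solution N f (ball_data eps L) u -> nonneg_solution N f u.
Proof.
  intros Hf0 Hf1 HL Heps Hu. split; [|now split; apply Hu].
  intros t x Ht. now apply (solution_bounds N f eps L u Hf0 Hf1 HL Heps Hu).
Qed.

Lemma solution_starts_above N f (eps L l : R) u :
  0 < l <= L ^ 2 -> is_solution N f (ball_data eps L) u -> starts_above u eps l.
Proof.
  intros Hl Hu x Hx e He.
  destruct (solution_initial_limit N f eps L u x Hu ltac:(lra) e He) as (d & Hd & H).
  exists d. split; [easy|]. intros s y Hs Hy. specialize (H s y Hs Hy).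
  unfold ball_data in H. destruct (Rlt_dec (sqnorm x) (L ^ 2)); [|lra].
  apply Rabs_lt_between in H. lra.
Qed.

Lemma nonneg_solution_shift N f u (t1 : R) :
  0 <= t1 -> nonneg_solution N f u -> nonneg_solution N f (fun t x => u (t1 + t) x).
Proof.
  intros Ht1 (Hpos & Hcont & Hpde). split; [|split].
  - intros t x Ht. apply Hpos. lra.
  - intros t x Ht e He. destruct (Hcont (t1 + t) x ltac:(lra) e He) as (d & Hd & H).
    exists d. split; [easy|]. intros s y Hs Hst. apply H; [lra|].
    now replace (t1 + s - (t1 + t)) with (s - t) by ring.
  - intros t x Ht. destruct (Hpde (t1 + t) x ltac:(lra)) as (ut & e & H1 & H2 & H3).
    exists ut, e. repeat split; try easy.
    intros eps Heps. destruct (H1 eps Heps) as [d Hd]. exists d. intros h Hh Hhd.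
    rewrite <- Rplus_assoc. now apply Hd.
Qed.

Lemma shift_starts_above N f u (t1 g l : R) :
  0 < t1 -> nonneg_solution N f u -> (forall x, sqnorm x < l -> g <= u t1 x) ->
  starts_above (fun t x => u (t1 + t) x) g l.
Proof.
  intros Ht1 (_ & Hcont & _) Hg x Hx e He.
  destruct (Hcont t1 x Ht1 e He) as (d & Hd & H). exists d. split; [easy|].
  intros s y Hs Hy. specialize (H (t1 + s) y ltac:(lra)).
  replace (t1 + s - t1) with s in H by ring. rewrite Rabs_pos_eq in H by lra.
  specialize (H ltac:(lra) Hy). apply Rabs_lt_between in H. specialize (Hg x Hx). lra.
Qed.

(** In the variable rho = |x|^2. The inequality is required only where w > 0, since solutions are
    nonnegative; w may be negative and non-smooth elsewhere. *)
Definition radial_subsolution (N : nat) (f : R -> R) (T : R) (w : R -> R -> R) : Prop :=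
  forall t rho, 0 < t <= T -> 0 <= rho -> 0 < w t rho ->
    exists (wt r d2 : R) (d1 : R -> R), 0 < r /\
      derivable_pt_lim (fun s => w s rho) t wt /\
      (forall rho', Rabs (rho' - rho) < r -> derivable_pt_lim (w t) rho' (d1 rho')) /\
      derivable_pt_lim d1 rho d2 /\
      wt <= 2 * INR N * d1 rho + 4 * rho * d2 + f (w t rho).

(** Subtracting mu exp (k t), with k above the Lipschitz constant, makes the subsolution strict: at
    a touching point f (w) - f (u) would be at least k (w - u). There 0 <= u < w <= 1, so the
    Lipschitz bound on [0,1] contradicts this. The value of [mu] puts a zero of z at (t0, x0). *)
Lemma comparison N f u (w : R -> R -> R) (T B g l K : R) :
  0 < T -> 0 <= B -> 0 <= g ->
  (forall a b, 0 <= a <= 1 -> 0 <= b <= 1 -> Rabs (f a - f b) <= K * Rabs (a - b)) ->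
  nonneg_solution N f u -> starts_above u g l ->
  (forall t rho, 0 <= t <= T -> 0 <= rho -> continuity_2d_pt w t rho) ->
  (forall t rho, 0 < t <= T -> B ^ 2 < rho -> w t rho <= 0) ->
  (forall rho, 0 <= rho -> w 0 rho <= g) ->
  (forall rho, l <= rho -> w 0 rho <= 0) ->
  (forall t rho, 0 < t <= T -> 0 <= rho -> w t rho <= 1) ->
  radial_subsolution N f T w ->
  forall t x, 0 < t <= T -> w t (sqnorm x) <= u t x.
Proof.
  intros HT HB Hg HK (Hpos & Hcont & Hpde) Habove Hwc Hwout Hw0 Hw0' Hw1 Hsub t0 x0 Ht0.
  apply Rnot_lt_le; intros Hlt.
  set (k := Rabs K + 1). assert (Hk : 0 < k /\ K < k).
  { unfold k. pose proof (Rabs_pos K). pose proof (Rle_abs K). lra. }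
  set (mu := (w t0 (sqnorm x0) - u t0 x0) * exp (- (k * t0))).
  assert (Hmu : 0 < mu) by (apply Rmult_lt_0_compat; [lra | apply exp_pos]).
  assert (Hmuexp : forall s, 0 < s -> mu <= mu * exp (k * s)).
  { intros s Hs. rewrite <- (Rmult_1_r mu) at 1. apply Rmult_le_compat_l; [lra|].
    rewrite <- exp_0. apply exp_le_mono. nra. }
  set (phi := fun s rho => w s rho - mu * exp (k * s)).
  assert (Hphic : forall t rho, 0 <= t <= T -> 0 <= rho -> continuity_2d_pt phi t rho).
  { intros t rho Ht Hrho. unfold phi. apply continuity_2d_pt_minus; [now apply Hwc|]. cont2d. }
  set (z := fun s (y : RN N) => phi s (sqnorm y) - u s y).
  destruct (first_touch N z T B) as (t & x & Ht & Hx & Hpast); try easy.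
  - intros x. pose proof (sqnorm_nonneg N x) as Hx.
    destruct (radial_continuous N w 0 x (mu / 2)) as (d1 & Hd1 & H1); [|lra|].
    { apply Hwc; lra. }
    assert (Hu : exists d, 0 < d /\ forall s y, 0 < s < d -> sqdist y x < d ^ 2 ->
      w 0 (sqnorm x) - mu / 2 < u s y).
    { destruct (Rlt_le_dec (sqnorm x) l) as [Hxl|Hxl].
      - destruct (Habove x Hxl (mu / 2) ltac:(lra)) as (d & Hd & H). exists d.
        split; [easy|]. intros s y Hs Hy. specialize (H s y Hs Hy).
        specialize (Hw0 (sqnorm x) Hx). lra.
      - exists 1. split; [lra|]. intros s y Hs _. specialize (Hpos s y ltac:(lra)).
        specialize (Hw0' _ Hxl). lra. }
    destruct Hu as (d2 & Hd2 & H2).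
    assert (0 < Rmin d1 d2) by now apply Rmin_pos.
    pose proof (Rmin_l d1 d2). pose proof (Rmin_r d1 d2).
    exists (Rmin d1 d2). split; [easy|]. intros s y Hs Hy.
    specialize (H1 s y). rewrite Rminus_0_r, Rabs_pos_eq in H1 by lra.
    specialize (H1 ltac:(lra) (sqdist_lt_mono N x y (Rmin d1 d2) d1 ltac:(lra) Hy)).
    specialize (H2 s y ltac:(lra) (sqdist_lt_mono N x y (Rmin d1 d2) d2 ltac:(lra) Hy)).
    apply Rabs_lt_between in H1. specialize (Hmuexp s ltac:(lra)).
    unfold z, phi. lra.
  - intros t x Ht Hx. set (e := - z t x / 2).
    assert (He : 0 < e) by (unfold e; lra).
    destruct (radial_continuous N phi t x e) as (d1 & Hd1 & H1); [| easy |].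
    { apply Hphic; [lra | apply sqnorm_nonneg]. }
    destruct (Hcont t x ltac:(lra) e He) as (d2 & Hd2 & H2).
    exists (Rmin d1 d2). assert (0 < Rmin d1 d2) by now apply Rmin_pos.
    pose proof (Rmin_l d1 d2). pose proof (Rmin_r d1 d2).
    split; [easy|]. intros s y Hs Hst Hy.
    specialize (H1 s y ltac:(lra) (sqdist_lt_mono N x y (Rmin d1 d2) d1 ltac:(lra) Hy)).
    specialize (H2 s y Hs ltac:(lra) (sqdist_lt_mono N x y (Rmin d1 d2) d2 ltac:(lra) Hy)).
    apply Rabs_lt_between in H1. apply Rabs_lt_between in H2.
    unfold e, z in *. lra.
  - intros t x Ht Hx. specialize (Hwout t _ Ht Hx). specialize (Hpos t x ltac:(lra)).
    specialize (Hmuexp t ltac:(lra)). unfold z, phi. lra.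
  - exists t0, x0. split; [easy|]. unfold z, phi, mu.
    rewrite Rmult_assoc, <- exp_plus, Rplus_opp_l, exp_0. lra.
  - assert (Hwpos : forall y, 0 <= z t y -> 0 < w t (sqnorm y)).
    { intros y Hy. specialize (Hpos t y ltac:(lra)). specialize (Hmuexp t ltac:(lra)).
      unfold z, phi in Hy. lra. }
    assert (Hphit : forall rho wt, derivable_pt_lim (fun s => w s rho) t wt ->
      derivable_pt_lim (fun s => phi s rho) t (wt - mu * k * exp (k * t))).
    { intros rho wt H. apply derivable_pt_lim_minus; [easy|].
      apply is_derive_Reals. auto_derive; [easy | ring]. }
    destruct (Hsub t (sqnorm x) Ht (sqnorm_nonneg N x) (Hwpos x Hx))
      as (wt & r & d2 & d1 & Hr & Hwt & Hd1 & Hd2 & Hle).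
    destruct (Hpde t x ltac:(lra)) as (ut & e & Hut & He & Heq).
    pose proof (touch N phi u t x (wt - mu * k * exp (k * t)) ut r d2 d1 e
      ltac:(lra) Hpast Hx) as Htouch.
    assert (H1 : forall y, 0 <= phi t (sqnorm y) - u t y ->
      exists l, derivable_pt_lim (fun s => phi s (sqnorm y)) t l).
    { intros y Hy. destruct (Hsub t (sqnorm y) Ht (sqnorm_nonneg N y) (Hwpos y Hy))
        as (wt' & _ & _ & _ & _ & Hwt' & _).
      eexists. exact (Hphit _ _ Hwt'). }
    assert (H2 : forall y, exists l, derivable_pt_lim (fun s => u s y) t l).
    { intros y. destruct (Hpde t y ltac:(lra)) as (l' & _ & H & _). now exists l'. }
    specialize (Htouch H1 H2 (Hphit _ _ Hwt) Hut Hr).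
    assert (H3 : forall rho, Rabs (rho - sqnorm x) < r ->
      derivable_pt_lim (phi t) rho (d1 rho)).
    { intros rho Hrho. unfold phi. rewrite <- (Rminus_0_r (d1 rho)).
      apply derivable_pt_lim_minus; [now apply Hd1 | apply derivable_pt_lim_const]. }
    destruct (Htouch H3 Hd2 He) as [Hz0 Hheat].
    assert (Hlip := HK (w t (sqnorm x)) (u t x)).
    specialize (Hw1 t (sqnorm x) Ht (sqnorm_nonneg N x)).
    specialize (Hwpos x Hx). specialize (Hpos t x ltac:(lra)).
    assert (Hgap : w t (sqnorm x) - u t x = mu * exp (k * t)) by (unfold phi in Hz0; lra).
    assert (Hgpos : 0 < mu * exp (k * t)) by (apply Rmult_lt_0_compat; [easy | apply exp_pos]).
    specialize (Hlip ltac:(lra) ltac:(lra)). rewrite Hgap, (Rabs_pos_eq (mu * _)) in Hlip by lra.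
    apply Rabs_le_between in Hlip. nra.
Qed.

(** * Growth by the nonlinearity *)

Lemma Rpower_pos (x y : R) : 0 < Rpower x y.
Proof. apply exp_pos. Qed.

Lemma Rpower_opp_antitone (x y a : R) : 0 <= a -> 0 < x <= y -> Rpower y (- a) <= Rpower x (- a).
Proof.
  intros Ha Hxy. rewrite !Rpower_Ropp. apply Rinv_le_contravar; [apply Rpower_pos|].
  now apply Rle_Rpower_l.
Qed.

Lemma Rpower_opp_opp_inv (x b : R) : 0 < b -> 0 < x -> Rpower (Rpower x (- b)) (- / b) = x.
Proof.
  intros Hb Hx. rewrite Rpower_mult. replace (- b * - / b) with 1 by (field; lra).
  now apply Rpower_1.
Qed.

Lemma Rpower_le_1 (x b : R) : 0 <= b -> 0 < x <= 1 -> Rpower x b <= 1.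
Proof.
  intros Hb Hx. replace 1 with (Rpower 1 b) by (unfold Rpower; rewrite ln_1, Rmult_0_r; apply exp_0).
  now apply Rle_Rpower_l.
Qed.

(* [Rpower x b] is [1] for [x <= 0], hence the case distinction. *)
Definition pos_power (b x : R) : R := if Rlt_dec 0 x then Rpower x b else 0.

Lemma pos_power_pos (b x : R) : 0 < x -> pos_power b x = Rpower x b.
Proof. intros Hx. unfold pos_power. now destruct (Rlt_dec 0 x). Qed.

Lemma pos_power_bounds (b x : R) : 0 < b -> x <= 1 -> 0 <= pos_power b x <= 1.
Proof.
  intros Hb Hx. unfold pos_power. destruct (Rlt_dec 0 x); [|lra].
  split; [left; apply Rpower_pos | apply Rpower_le_1; lra].
Qed.

Lemma locally_pos (g : R -> R) (x : R) :
  continuity_pt g x -> 0 < g x -> locally x (fun y => 0 < g y).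
Proof.
  intros Hc Hg. apply continuity_pt_filterlim in Hc.
  apply Hc. apply (open_gt 0 (g x) Hg).
Qed.

Lemma pos_power_continuous (b x : R) : 0 < b -> continuity_pt (pos_power b) x.
Proof.
  intros Hb. destruct (Rtotal_order x 0) as [Hx|[Hx|Hx]].
  - apply (continuity_pt_ext_loc (fun _ => 0)).
    + exists (mkposreal (- x) ltac:(lra)). intros y Hy.
      unfold ball in Hy; simpl in Hy. unfold AbsRing_ball, abs, minus, plus, opp in Hy; simpl in Hy.
      apply Rabs_lt_between in Hy. unfold pos_power. destruct (Rlt_dec 0 y); [lra | easy].
    + apply continuity_pt_const. now intros u v.
  - subst x. intros e He. exists (Rpower e (/ b)). split; [apply Rpower_pos|].
    intros y [_ Hy]. simpl in *. unfold Rdist in *. rewrite Rminus_0_r in Hy.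
    unfold pos_power. destruct (Rlt_dec 0 0); [lra|]. rewrite Rminus_0_r.
    destruct (Rlt_dec 0 y) as [Hy0|Hy0]; [|now rewrite Rabs_R0].
    rewrite Rabs_pos_eq in Hy by lra. rewrite Rabs_pos_eq by (left; apply Rpower_pos).
    replace e with (Rpower (Rpower e (/ b)) b).
    + now apply Rlt_Rpower_l.
    + rewrite Rpower_mult, Rinv_l by lra. now apply Rpower_1.
  - apply (continuity_pt_ext_loc (fun y => Rpower y b)).
    + apply (filter_imp (fun y => 0 < y)).
      * intros y Hy. now rewrite pos_power_pos.
      * apply (locally_pos (fun y => y)); [apply continuity_pt_id | easy].
    + apply derivable_continuous_pt. eexists. now apply derivable_pt_lim_power.
Qed.

(** With E the exponential, F_t = - s E and the Laplacian of F is - E (2 N g + 4 g^2 rho). For g > 0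
    and s, t >= 0 the positive part lies in rho <= l, so F is a heat subsolution there once s >= 2 N
    g + 4 g^2 l. *)
Definition front (s g l t rho : R) : R := 1 - exp (s * t + g * (rho - l)).

(* The solution at time [t] of [y' = c y^(b+1)], [k = c b], with [y(0) = Q^(-1/b) F]. It is
   convex in [F], so it turns a subsolution [F] of the heat equation into one of
   [u_t = Delta u + c u^(b+1)]. *)
Definition profile (b Q k t F : R) : R := F * Rpower (Q - k * t * pos_power b F) (- / b).

Lemma front_lt_1 (s g l t rho : R) : front s g l t rho < 1.
Proof. unfold front. pose proof (exp_pos (s * t + g * (rho - l))). lra. Qed.

Lemma front_continuous (s g l t rho : R) : continuity_2d_pt (front s g l) t rho.
Proof. unfold front. cont2d. Qed.

Lemma profile_denominator_pos (b Q k T t F : R) :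
  0 < b -> 0 <= k -> k * T < Q -> 0 <= t <= T -> F <= 1 ->
  Q - k * T <= Q - k * t * pos_power b F.
Proof.
  intros Hb Hk HT Ht HF. pose proof (pos_power_bounds b F Hb HF).
  assert (0 <= k * t <= k * T) by nra. nra.
Qed.

Lemma profile_continuous (b Q k T s g l t rho : R) :
  0 < b -> 0 <= k -> k * T < Q -> 0 <= t <= T ->
  continuity_2d_pt (fun t rho => profile b Q k t (front s g l t rho)) t rho.
Proof.
  intros Hb Hk HT Ht.
  pose proof (profile_denominator_pos b Q k T t (front s g l t rho) Hb Hk HT Ht
    (Rlt_le _ _ (front_lt_1 _ _ _ _ _))).
  unfold profile, Rpower.
  apply continuity_2d_pt_mult; [apply front_continuous|].
  apply continuity_2d_exp. apply continuity_2d_pt_mult; [apply continuity_2d_pt_const|].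
  apply continuity_2d_ln; [lra|].
  apply continuity_2d_pt_minus; [apply continuity_2d_pt_const|].
  apply continuity_2d_pt_mult; [cont2d|].
  apply (continuity_1d_2d_pt_comp (pos_power b)); [now apply pos_power_continuous|].
  apply front_continuous.
Qed.

Lemma profile_nonpos (b Q k t F : R) : F <= 0 -> profile b Q k t F <= 0.
Proof.
  intros HF. unfold profile. pose proof (Rpower_pos (Q - k * t * pos_power b F) (- / b)). nra.
Qed.

(** The flow is largest for F = 1, and then its power - b is Q - k t, which decreases to theta^(-b)
    at time T. *)
Lemma profile_le (b Q k T t F theta : R) :
  0 < b -> 0 <= k -> 0 < theta -> k * T = Q - Rpower theta (- b) -> 0 <= t <= T -> F <= 1 ->
  profile b Q k t F <= theta.
Proof.
  intros Hb Hk Hth HT Ht HF. pose proof (Rpower_pos theta (- b)) as Hp.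
  destruct (Rlt_le_dec 0 F) as [HF0|HF0]; [|pose proof (profile_nonpos b Q k t F HF0); lra].
  pose proof (profile_denominator_pos b Q k T t F Hb Hk ltac:(lra) Ht HF) as HD.
  unfold profile.
  assert (H : Rpower (Q - k * t * pos_power b F) (- / b) <= theta).
  { rewrite <- (Rpower_opp_opp_inv theta b Hb Hth) at 1. apply Rpower_opp_antitone; [|lra].
    left. now apply Rinv_0_lt_compat. }
  pose proof (Rpower_pos (Q - k * t * pos_power b F) (- / b)). nra.
Qed.

(** Let W (t, F) be the profile. By the chain rule w_t minus the Laplacian of w is c w^(b+1) + W_F
    (F_t - Lap F) - W_FF |grad F|^2. Here W_F > 0, W_FF >= 0 and F_t <= Lap F, while c w^(b+1) <= f
    (w) because w <= theta. *)
Lemma profile_subsolution N f (b c theta Q k T s g l : R) :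
  0 < b -> 0 < c -> k = c * b -> 0 < theta -> 0 <= g ->
  (forall v, 0 < v <= theta -> c * Rpower v (b + 1) <= f v) ->
  k * T = Q - Rpower theta (- b) -> 0 <= s ->
  2 * INR N * g + 4 * g ^ 2 * l <= s ->
  radial_subsolution N f T (fun t rho => profile b Q k t (front s g l t rho)).
Proof.
  intros Hb Hc Hk Hth Hg Hf HT Hs Hsg t rho Ht Hrho Hw.
  pose proof (Rpower_pos theta (- b)) as Hp.
  assert (Hk0 : 0 < k) by nra.
  assert (HF1 := front_lt_1 s g l t). pose proof (fun r => Rlt_le _ _ (HF1 r)) as HF1'.
  assert (HF0 : 0 < front s g l t rho).
  { apply Rnot_le_lt; intros H. pose proof (profile_nonpos b Q k t _ H). lra. }
  assert (HD : forall rho', 0 < front s g l t rho' ->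
    0 < Q - k * t * Rpower (front s g l t rho') b).
  { intros rho' H. pose proof (profile_denominator_pos b Q k T t (front s g l t rho') Hb
      (Rlt_le _ _ Hk0) ltac:(lra) ltac:(lra) (HF1' rho')) as HD.
    rewrite pos_power_pos in HD by easy. lra. }
  pose proof (profile_le b Q k T t _ theta Hb (Rlt_le _ _ Hk0) Hth HT ltac:(lra) (HF1' rho)) as Hwth.
  specialize (Hf _ (conj Hw Hwth)).
  set (Ex := fun t rho => exp (s * t + g * (rho - l))).
  set (F := front s g l) in *.
  set (D := fun t rho => Q - k * t * Rpower (F t rho) b) in *.
  (* the derivative of [profile] in [F], at [F = F t rho] *)
  set (WF := fun rho => Q * Rpower (D t rho) (- / b - 1)).
  set (WFF := Q * ((/ b + 1) * Rpower (D t rho) (- / b - 2) *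
                (k * t * b * Rpower (F t rho) (b - 1)))).
  assert (Hlocx : forall rho0, 0 < F t rho0 -> locally rho0 (fun rho => 0 < F t rho)).
  { intros rho0 H. apply locally_pos; [|easy]. apply derivable_continuous_pt.
    exists (- (g * Ex t rho0)). apply is_derive_Reals. unfold F, front, Ex.
    auto_derive; [easy | ring_simplify; reflexivity]. }
  assert (Hloct : locally t (fun t => 0 < F t rho)).
  { apply (locally_pos (fun t => F t rho)); [|easy]. apply derivable_continuous_pt.
    exists (- (s * Ex t rho)). apply is_derive_Reals. unfold F, front, Ex.
    auto_derive; [easy | ring_simplify; reflexivity]. }
  destruct (Hlocx rho HF0) as [r Hr].
  exists (c * Rpower (profile b Q k t (F t rho)) (b + 1) - WF rho * (s * Ex t rho)), r,
    (WFF * (g * Ex t rho) ^ 2 - WF rho * (g ^ 2 * Ex t rho)),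
    (fun rho => - (WF rho * (g * Ex t rho))).
  assert (HQ : 0 < Q).
  { assert (0 <= k * T) by nra. lra. }
  split; [apply cond_pos|]. split; [|split; [|split]].
  - apply is_derive_Reals.
    apply (is_derive_ext_loc (fun t =>
      F t rho * exp (- / b * ln (Q - k * t * exp (b * ln (F t rho)))))).
    { apply (filter_imp (fun t => 0 < F t rho)); [|easy].
      intros t' Ht'. unfold profile. now rewrite pos_power_pos by easy. }
    specialize (HD rho HF0). unfold WF.
    (* All powers are rewritten through F^b and D^(-1/b), so that [field] can treat these
       exponentials as atoms. *)
    replace (Rpower (profile b Q k t (F t rho)) (b + 1)) with
      (F t rho * Rpower (F t rho) b * (Rpower (D t rho) (- / b) / D t rho)).
    + replace (Rpower (D t rho) (- / b - 1)) with (Rpower (D t rho) (- / b) / D t rho).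
      * unfold D, F, front, Ex, Rpower in *. unfold Rminus in *. auto_derive.
        -- repeat split; lra.
        -- set (E := exp (s * t + g * (rho + - l))) in *.
           set (Y := exp (b * ln (1 + - E))) in *.
           set (X := exp (- / b * ln (Q + - (k * t * Y)))) in *.
           rewrite Hk in *. field. repeat split; lra.
      * unfold Rminus. rewrite Rpower_plus, (Rpower_Ropp _ 1), Rpower_1 by easy. reflexivity.
    + unfold profile. rewrite pos_power_pos by easy. fold (D t rho).
      rewrite <- Rpower_mult_distr by (try apply Rpower_pos; easy).
      rewrite Rpower_mult, Rpower_plus, Rpower_1 by easy.
      replace (- / b * (b + 1)) with (- / b + - (1)) by (field; lra).
      rewrite Rpower_plus, (Rpower_Ropp _ 1), Rpower_1 by easy. unfold Rdiv. ring.
  - intros rho' Hrho'. specialize (Hr rho' Hrho'). simpl in Hr.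
    specialize (HD rho' Hr). apply is_derive_Reals.
    apply (is_derive_ext_loc (fun rho =>
      F t rho * exp (- / b * ln (Q - k * t * exp (b * ln (F t rho)))))).
    { apply (filter_imp (fun rho => 0 < F t rho)); [|now apply Hlocx].
      intros t' Ht'. unfold profile. now rewrite pos_power_pos by easy. }
    unfold WF.
    replace (Rpower (D t rho') (- / b - 1)) with (Rpower (D t rho') (- / b) / D t rho').
    + unfold D, F, front, Ex, Rpower in *. unfold Rminus in *. auto_derive.
      * repeat split; lra.
      * set (E := exp (s * t + g * (rho' + - l))) in *.
        set (Y := exp (b * ln (1 + - E))) in *.
        set (X := exp (- / b * ln (Q + - (k * t * Y)))) in *.
        field. repeat split; lra.
    + unfold Rminus. rewrite Rpower_plus, (Rpower_Ropp _ 1), Rpower_1 by easy. reflexivity.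
  - specialize (HD rho HF0). apply is_derive_Reals.
    unfold WFF, WF.
    replace (Rpower (D t rho) (- / b - 2)) with (Rpower (D t rho) (- / b - 1) / D t rho).
    + replace (Rpower (F t rho) (b - 1)) with (Rpower (F t rho) b / F t rho).
      * unfold D, F, front, Ex, Rpower in *. unfold Rminus in *. auto_derive.
        -- repeat split; lra.
        -- set (E := exp (s * t + g * (rho + - l))) in *.
           set (Y := exp (b * ln (1 + - E))) in *.
           set (X := exp ((- / b + - (1)) * ln (Q + - (k * t * Y)))) in *.
           field. repeat split; lra.
      * unfold Rminus. rewrite Rpower_plus, (Rpower_Ropp _ 1), Rpower_1 by easy. reflexivity.
    + replace (- / b - 2) with (- / b - 1 + - (1)) by ring.
      rewrite Rpower_plus, (Rpower_Ropp _ 1), Rpower_1 by easy. reflexivity.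
  - assert (HWF : 0 < WF rho) by (apply Rmult_lt_0_compat; [easy | apply Rpower_pos]).
    assert (HE : 0 < Ex t rho) by apply exp_pos.
    assert (HWFF : 0 <= WFF).
    { assert (0 < / b) by now apply Rinv_0_lt_compat.
      unfold WFF. repeat apply Rmult_le_pos; try lra; left; apply Rpower_pos. }
    (* Positivity of F confines rho to the region where [front] is a heat subsolution. *)
    assert (Hrl : g * rho <= g * l).
    { apply Rnot_lt_le; intros H. unfold F, front in HF0.
      assert (exp 0 <= exp (s * t + g * (rho - l))) by (apply exp_le_mono; nra).
      rewrite exp_0 in *. lra. }
    assert (H1 : 0 <= WFF * (g * Ex t rho) ^ 2) by (apply Rmult_le_pos; [easy | apply pow2_ge_0]).
    assert (H2 : WF rho * Ex t rho * (2 * INR N * g + 4 * g ^ 2 * rho) <= WF rho * Ex t rho * s).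
    { apply Rmult_le_compat_l; [nra|]. nra. }
    nra.
Qed.

Lemma Rpower_one_minus_le (b E : R) :
  0 < b -> 0 <= E -> E <= 1 / 2 -> 4 * b * E <= 1 -> Rpower (1 - E) (- b) <= 1 + 4 * b * E.
Proof.
  intros Hb HE0 HE1 HE2.
  assert (Hln : - (2 * E) <= ln (1 - E)).
  { rewrite <- (ln_exp (- (2 * E))). apply ln_le; [apply exp_pos|].
    rewrite exp_Ropp. pose proof (exp_ineq1_le (2 * E)).
    apply Rle_trans with (/ (1 + 2 * E)); [apply Rinv_le_contravar; lra|].
    apply Rmult_le_reg_l with (1 + 2 * E); [lra|]. rewrite Rinv_r by lra. nra. }
  unfold Rpower. apply Rle_trans with (exp (2 * b * E)); [apply exp_le_mono; nra|].
  assert (H : exp (2 * b * E) <= / (1 - 2 * b * E)).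
  { rewrite <- (Rinv_inv (exp _)), <- exp_Ropp. apply Rinv_le_contravar; [lra|].
    pose proof (exp_ineq1_le (- (2 * b * E))). lra. }
  apply Rle_trans with (1 := H).
  apply Rmult_le_reg_l with (1 - 2 * b * E); [lra|]. rewrite Rinv_r by lra.
  assert (0 <= b * E) by nra.
  replace ((1 - 2 * b * E) * (1 + 4 * b * E)) with (1 + 2 * (b * E) * (1 - 4 * b * E)) by ring.
  nra.
Qed.

(** T is the time at which the flow from eps reaches theta. At T the subsolution satisfies w^(-b) =
    theta^(-b) + eps^(-b) (F^(-b) - 1), where F = 1 - E with E the exponential in [front]. As F^(-b)
    - 1 <= 4 b E, the level theta' is reached as soon as E is a small enough multiple of eps^b. *)
Lemma growth (b theta theta' : R) :
  0 < b -> 0 < theta' < theta -> theta <= 1 ->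
  exists e1, 0 < e1 /\
    forall N f (c K eps l : R) u,
      0 < c -> 0 < eps < theta -> 0 < l ->
      (forall v, 0 < v <= theta -> c * Rpower v (b + 1) <= f v) ->
      (forall x y, 0 <= x <= 1 -> 0 <= y <= 1 -> Rabs (f x - f y) <= K * Rabs (x - y)) ->
      nonneg_solution N f u -> starts_above u eps l ->
      let T := (Rpower eps (- b) - Rpower theta (- b)) / (c * b) in
      let g := c * b * Rpower eps b / 8 in
      0 < T /\
      forall x, exp (INR N / 4 + g * sqnorm x - g * l / 2) <= e1 * Rpower eps b ->
        theta' <= u T x.
Proof.
  intros Hb Hth Hth1.
  set (gap := Rpower theta' (- b) - Rpower theta (- b)).
  assert (Hstrict : forall y z, 0 < y < z -> Rpower z (- b) < Rpower y (- b)).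
  { intros y z Hyz. rewrite !Rpower_Ropp. apply Rinv_lt_contravar.
    - apply Rmult_lt_0_compat; apply Rpower_pos.
    - apply Rlt_Rpower_l; lra. }
  assert (Hgap : 0 < gap) by (pose proof (Hstrict theta' theta); unfold gap; lra).
  (* The first two bounds are the hypotheses of [Rpower_one_minus_le]; the third keeps the excess of
     w^(-b) below [gap]. *)
  set (e1 := Rmin (1 / 2) (Rmin (/ (4 * b)) (gap / (4 * b)))).
  assert (He1 : 0 < e1).
  { repeat apply Rmin_pos; [lra | apply Rinv_0_lt_compat; lra | apply Rdiv_lt_0_compat; lra]. }
  assert (He1' : e1 <= 1 / 2 /\ 4 * b * e1 <= 1 /\ 4 * b * e1 <= gap).
  { assert (e1 <= 1 / 2) by apply Rmin_l.
    assert (e1 <= / (4 * b)) by (eapply Rle_trans; [apply Rmin_r | apply Rmin_l]).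
    assert (e1 <= gap / (4 * b)) by (eapply Rle_trans; [apply Rmin_r | apply Rmin_r]).
    split; [easy|]. split.
    - replace 1 with (4 * b * / (4 * b)) by (field; lra). apply Rmult_le_compat_l; lra.
    - replace gap with (4 * b * (gap / (4 * b))) by (field; lra). apply Rmult_le_compat_l; lra. }
  exists e1. split; [easy|].
  intros N f c K eps l u Hc Heps Hl Hf HK Hu Habove T g.
  set (Q := Rpower eps (- b)) in *. set (Th := Rpower theta (- b)) in *.
  assert (HQTh : Th < Q) by now apply Hstrict.
  set (k := c * b) in *. assert (Hk : 0 < k) by (unfold k; nra).
  assert (HTh : 0 < Th) by apply Rpower_pos.
  assert (HT : 0 < T) by (apply Rdiv_lt_0_compat; lra).
  assert (HkT : k * T = Q - Th) by (unfold T; field; lra).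
  pose proof (Rpower_pos eps b) as Hpe.
  assert (HQe : Q * Rpower eps b = 1).
  { unfold Q. rewrite Rpower_Ropp. field. lra. }
  assert (Hg : 0 < g) by (unfold g; nra).
  assert (HgQ : g * Q = k / 8) by (unfold g; rewrite <- (Rmult_1_r (k / 8)), <- HQe; field).
  split; [easy|]. intros x Hx. pose proof (pos_INR N) as HN.
  set (s := 2 * INR N * g + 4 * g ^ 2 * l).
  assert (Hs : 0 < s).
  { assert (0 < g ^ 2 * l) by (apply Rmult_lt_0_compat; [now apply pow_lt | easy]).
    assert (0 <= INR N * g) by (apply Rmult_le_pos; lra). unfold s. lra. }
  set (w := fun t rho => profile b Q k t (front s g l t rho)).
  assert (Hfront0 : forall t rho, 0 <= t -> l <= rho -> front s g l t rho <= 0).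
  { intros t rho Ht Hrho. unfold front.
    assert (exp 0 <= exp (s * t + g * (rho - l))) by (apply exp_le_mono; nra).
    rewrite exp_0 in *. lra. }
  assert (Hcmp : w T (sqnorm x) <= u T x).
  { apply (comparison N f u w T (1 + l) eps l K); try easy; try lra.
    - intros t rho Ht _. apply (profile_continuous b Q k T); lra.
    - intros t rho Ht Hrho. apply profile_nonpos, Hfront0; [lra | nra].
    - intros rho _. unfold w. pose proof (front_lt_1 s g l 0 rho) as H1.
      apply (profile_le b Q k 0); try lra. fold Q. ring.
    - intros rho Hrho. now apply profile_nonpos, Hfront0; [lra|].
    - intros t rho Ht _. apply Rle_trans with theta; [|easy].
      apply (profile_le b Q k T); try easy; try lra. left; apply front_lt_1.
    - apply (profile_subsolution N f b c theta Q k T s g l); try easy; lra. }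
  apply Rle_trans with (2 := Hcmp). unfold w, profile.
  set (E := exp (s * T + g * (sqnorm x - l))).
  assert (HE0 : 0 < E) by apply exp_pos.
  assert (HE : E <= e1 * Rpower eps b).
  { apply Rle_trans with (2 := Hx). apply exp_le_mono.
    (* The 8 in [g] serves here: with g T <= 1 / 8, the term 4 g^2 l T uses up at most half of the
       margin g l. *)
    assert (HgT : g * T <= 1 / 8).
    { apply Rmult_le_reg_l with k; [easy|].
      replace (k * (g * T)) with (g * (k * T)) by ring. rewrite HkT. nra. }
    assert (s * T <= INR N / 4 + g * l / 2).
    { unfold s. replace ((2 * INR N * g + 4 * g ^ 2 * l) * T) with
        (2 * INR N * (g * T) + 4 * (g * l) * (g * T)) by ring.
      assert (0 < g * l) by nra. nra. }
    lra. }
  assert (Hpe1 : Rpower eps b <= 1) by (apply Rpower_le_1; lra).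
  assert (HEe1 : E <= e1) by nra.
  set (F := front s g l T (sqnorm x)).
  assert (HF : F = 1 - E) by reflexivity.
  assert (HF0 : 0 < F) by lra.
  rewrite pos_power_pos by easy. rewrite HkT.
  assert (HFb : Rpower F (- b) * Rpower F b = 1).
  { rewrite <- Rpower_plus, Rplus_opp_l. now apply Rpower_O. }
  assert (HD : 0 < Q - (Q - Th) * Rpower F b).
  { assert (Rpower F b <= 1) by (apply Rpower_le_1; lra). nra. }
  pose proof (Rpower_pos F (- b)) as HFpos.
  rewrite <- (Rpower_opp_opp_inv F b Hb HF0) at 1.
  rewrite Rpower_mult_distr by easy.
  replace (Rpower F (- b) * (Q - (Q - Th) * Rpower F b)) with
    (Q * (Rpower F (- b) - 1) + Th) by nra.
  rewrite <- (Rpower_opp_opp_inv theta' b Hb) at 1 by lra.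
  assert (HFle : Rpower F (- b) <= 1 + 4 * b * E).
  { rewrite HF. apply Rpower_one_minus_le; nra. }
  assert (HF1 : 1 <= Rpower F (- b)).
  { rewrite <- HFb. assert (Rpower F b <= 1) by (apply Rpower_le_1; lra). nra. }
  apply Rpower_opp_antitone; [left; now apply Rinv_0_lt_compat|].
  assert (HQ0 : 0 < Q) by lra.
  assert (HQ1 : Q * (Rpower F (- b) - 1) <= Q * (4 * b * E)) by (apply Rmult_le_compat_l; lra).
  assert (HQ2 : Q * (4 * b * E) <= 4 * b * e1).
  { replace (4 * b * e1) with (Q * (4 * b * (e1 * Rpower eps b))).
    - apply Rmult_le_compat_l; [lra|]. apply Rmult_le_compat_l; lra.
    - transitivity (4 * b * e1 * (Q * Rpower eps b)); [ring | rewrite HQe; ring]. }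
  assert (0 <= Q * (Rpower F (- b) - 1)) by (apply Rmult_le_pos; lra).
  unfold gap in *. lra.
Qed.

(** * Spreading and invasion *)

Lemma spreading_subsolution N f (A l m T : R) :
  (1 <= N)%nat -> 0 < A -> 0 < m -> 3 * A * (1 + 2 * INR N) <= m * l ->
  (forall v, 0 < v <= A -> 0 <= f v) ->
  (forall v, A / (INR N + 1) ^ 3 <= v <= A -> m <= f v) ->
  radial_subsolution N f T (fun t rho => A * (1 - rho / (l + t)) ^ 3).
Proof.
  intros HN HA Hm Hl Hf0 Hfm t rho Ht Hrho Hw.
  assert (Hn : 1 <= INR N) by (apply (le_INR 1); easy). set (n := INR N) in *.
  assert (Hl0 : 0 < l) by nra.
  set (tau := l + t). assert (Htau : 0 < tau) by (unfold tau; lra).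
  fold tau in Hw.
  set (y := 1 - rho / tau) in *.
  assert (Hy : 0 < y <= 1).
  { split.
    - apply Rnot_le_lt; intros H. assert (y ^ 3 <= 0) by nra. nra.
    - unfold y. assert (0 <= rho / tau); [|lra].
      apply Rmult_le_pos; [easy|]. left; now apply Rinv_0_lt_compat. }
  exists (3 * A * y ^ 2 * (1 - y) / tau), 1, (6 * A * y / tau ^ 2),
    (fun rho => - 3 * A * (1 - rho / tau) ^ 2 / tau).
  split; [lra|]. split; [|split; [|split]].
  - apply is_derive_Reals. unfold y, tau in *. auto_derive; [lra|]. simpl. field. lra.
  - intros rho' _. apply is_derive_Reals. fold tau. auto_derive; [lra|]. simpl. field. lra.
  - apply is_derive_Reals. unfold y. auto_derive; [lra|]. simpl. field. lra.
  - fold tau y. set (v := A * y ^ 3) in *.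
    assert (Hrho' : rho = tau * (1 - y)) by (unfold y; field; lra).
    assert (Hv : v <= A).
    { unfold v. assert (y ^ 2 <= 1) by nra. assert (y ^ 3 <= 1) by nra. nra. }
    assert (Hgoal : 3 * A * y / tau * (y * (1 - y + 2 * n) - 8 * (1 - y))
      <= f v).
    { destruct (Rle_lt_dec (y * (n + 1)) 1) as [Hys|Hys].
      - apply Rle_trans with 0; [|now apply Hf0].
        assert (0 < 3 * A * y / tau).
        { apply Rdiv_lt_0_compat; [nra | easy]. }
        assert (y <= 1 / 2) by nra.
        assert (y * (1 - y + 2 * n) - 8 * (1 - y) <= 0) by nra. nra.
      - apply Rle_trans with m.
        + apply Rle_trans with (3 * A * (1 + 2 * n) / tau).
          * unfold Rdiv. assert (Hit : 0 < / tau) by now apply Rinv_0_lt_compat.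
            replace (3 * A * y * / tau * (y * (1 - y + 2 * n) - 8 * (1 - y)))
              with (3 * A * / tau * (y * (y * (1 - y + 2 * n) - 8 * (1 - y)))) by ring.
            replace (3 * A * (1 + 2 * n) * / tau) with (3 * A * / tau * (1 + 2 * n)) by ring.
            apply Rmult_le_compat_l; [nra|].
            assert (y * y <= 1) by nra. nra.
          * apply Rle_div_l; [easy|]. unfold tau. nra.
        + apply Hfm. split; [|easy]. unfold v. apply Rle_div_l; [apply pow_lt; lra|].
          replace (A * y ^ 3 * (n + 1) ^ 3) with (A * (y * (n + 1)) ^ 3) by ring.
          assert (1 <= (y * (n + 1)) ^ 3) by (apply pow_R1_Rle; lra). nra. }
    rewrite Hrho'.
    match goal with |- ?X <= ?Y + f v =>
      replace X with (Y + 3 * A * y / tau *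
        (y * (1 - y + 2 * n) - 8 * (1 - y))) by (field; lra) end.
    lra.
Qed.

(** Near 0 this is the positive lower limit of f (u) / u^p; on [delta, theta] the continuous f has a
    positive minimum, and v^p <= 1. *)
Lemma power_lower_bound f (p theta : R) :
  assumption_M f p -> theta < 1 ->
  exists c, 0 < c /\ forall v, 0 < v <= theta -> c * Rpower v p <= f v.
Proof.
  intros (Hp & Hlip & _ & _ & Hpos & c1 & c2 & delta & Hc1 & Hdelta & Hlim) Hth.
  assert (Hsmall : forall v, 0 < v < delta -> c1 * Rpower v p <= f v).
  { intros v Hv. apply Rle_div_r; [apply Rpower_pos|]. now apply Hlim. }
  destruct (Rlt_le_dec theta delta) as [Htd|Htd].
  { exists c1. split; [easy|]. intros v Hv. apply Hsmall. lra. }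
  destruct (continuity_ab_min f delta theta Htd) as (mx & Hmin & Hmx).
  { intros v Hv e He. destruct (Hlip (v - 1) (v + 1)) as [K HK].
    set (k := Rabs K + 1).
    assert (Hk : 0 < k /\ K < k).
    { unfold k. pose proof (Rabs_pos K). pose proof (Rle_abs K). lra. }
    exists (Rmin 1 (e / k)). split.
    { apply Rmin_pos; [lra|]. apply Rdiv_lt_0_compat; lra. }
    intros y [_ Hy]. simpl in *. unfold Rdist in *.
    pose proof (Rmin_l 1 (e / k)). pose proof (Rmin_r 1 (e / k)).
    assert (Hyv : -1 < y - v < 1) by (apply Rabs_lt_between; lra).
    apply Rle_lt_trans with (K * Rabs (y - v)); [apply HK; lra|].
    pose proof (Rabs_pos (y - v)).
    apply Rle_lt_trans with (k * Rabs (y - v)); [nra|].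
    apply Rlt_le_trans with (k * (e / k)); [apply Rmult_lt_compat_l; lra|].
    right. field. lra. }
  assert (Hm : 0 < f mx) by (apply Hpos; lra).
  exists (Rmin c1 (f mx)). split; [now apply Rmin_pos|]. intros v Hv.
  pose proof (Rmin_l c1 (f mx)). pose proof (Rmin_r c1 (f mx)). pose proof (Rpower_pos v p).
  destruct (Rlt_le_dec v delta) as [Hvd|Hvd].
  - apply Rle_trans with (c1 * Rpower v p); [nra | apply Hsmall; lra].
  - assert (Rpower v p <= 1) by (apply Rpower_le_1; lra).
    apply Rle_trans with (f mx); [|apply Hmin; lra].
    assert (0 < Rmin c1 (f mx)) by now apply Rmin_pos. nra.
Qed.

Lemma spreading N f (c p A K : R) :
  (1 <= N)%nat -> 0 <= p -> 0 < A <= 1 -> 0 < c ->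
  (forall v, 0 < v <= A -> c * Rpower v p <= f v) ->
  (forall x y, 0 <= x <= 1 -> 0 <= y <= 1 -> Rabs (f x - f y) <= K * Rabs (x - y)) ->
  exists l, 0 < l /\ forall u, nonneg_solution N f u -> starts_above u A l ->
    forall t x, 0 < t -> 2 * sqnorm x <= l + t -> A / 8 <= u t x.
Proof.
  intros HN Hp HA Hc Hf HK. pose proof (pos_INR N) as Hn.
  (* [h] is the value of the subsolution at 1 - rho / (l + t) = 1 / (N + 1), [m] bounds f from below
     on [h, A], and [l] gives equality in the size condition of [spreading_subsolution]. The final A
     / 8 is A (1 / 2)^3, the value at rho = (l + t) / 2. *)
  set (h := A / (INR N + 1) ^ 3).
  assert (Hh : 0 < h) by (apply Rdiv_lt_0_compat; [lra | apply pow_lt; lra]).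
  set (m := c * Rpower h p).
  assert (Hm : 0 < m) by (apply Rmult_lt_0_compat; [easy | apply Rpower_pos]).
  set (l := 3 * A * (1 + 2 * INR N) / m).
  assert (Hl : 0 < l) by (apply Rdiv_lt_0_compat; [apply Rmult_lt_0_compat; lra | easy]).
  exists l. split; [easy|]. intros u Hu Habove t x Ht Hx.
  set (w := fun t rho => A * (1 - rho / (l + t)) ^ 3).
  assert (Hquot : forall s rho, 0 <= s -> 0 <= rho -> 0 <= rho / (l + s)).
  { intros s rho Hs Hrho. apply Rmult_le_pos; [easy|]. left. apply Rinv_0_lt_compat. lra. }
  assert (Hle : forall s rho, 0 <= s -> 0 <= rho -> w s rho <= A).
  { intros s rho Hs Hrho. unfold w. specialize (Hquot s rho Hs Hrho).
    set (y := rho / (l + s)) in *.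
    assert (H : (1 - y) ^ 3 <= 1).
    2: { rewrite <- (Rmult_1_r A) at 2. apply Rmult_le_compat_l; lra. }
    assert (1 - (1 - y) ^ 3 = y * ((y - 3 / 2) ^ 2 + 3 / 4)) by field.
    pose proof (pow2_ge_0 (y - 3 / 2)). nra. }
  assert (Hneg : forall s rho, 0 <= s -> l + s <= rho -> w s rho <= 0).
  { intros s rho Hs Hrho. unfold w.
    assert (1 <= rho / (l + s)) by (apply Rle_div_r; lra).
    set (y := rho / (l + s)) in *.
    assert ((1 - y) ^ 3 <= 0); [|nra].
    replace ((1 - y) ^ 3) with (- ((y - 1) * (y - 1) ^ 2)) by ring.
    pose proof (pow2_ge_0 (y - 1)). nra. }
  apply Rle_trans with (w t (sqnorm x)).
  - unfold w. assert (sqnorm x / (l + t) <= 1 / 2) by (apply Rle_div_l; lra).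
    set (y := sqnorm x / (l + t)) in *.
    assert ((1 / 2) ^ 3 <= (1 - y) ^ 3) by (apply pow_incr; lra). nra.
  - apply (comparison N f u w t (1 + l + t) A l K); try easy; try lra.
    + intros s rho Hs Hrho. unfold w, Rdiv, pow. cont2d;
        (apply continuity_2d_pt_inv; [cont2d | lra]).
    + intros s rho Hs Hrho. apply Hneg; nra.
    + intros rho Hrho. apply Hle; lra.
    + intros rho Hrho. apply Hneg; lra.
    + intros s rho Hs Hrho. apply Rle_trans with A; [apply Hle; lra | lra].
    + apply (spreading_subsolution N f A l m t); try easy; try lra.
      * right. unfold l. field. lra.
      * intros v Hv. specialize (Hf v Hv). pose proof (Rpower_pos v p). nra.
      * fold h. intros v Hv. apply Rle_trans with (c * Rpower v p); [|apply Hf; lra].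
        unfold m. apply Rmult_le_compat_l; [lra|]. apply Rle_Rpower_l; lra.
Qed.

(** To estimate u at a late time t, restart at t - T, with [T] the fixed time that [growth] needs
    from the level a. By then spreading gives u >= a on |x|^2 < l, with [l] so large that growth
    reaches 1 - e throughout |x| <= Rad. *)
Lemma invasion N f u (b t1 l0 a K : R) :
  0 < b -> assumption_M f (b + 1) -> 0 < a <= 1 / 2 -> 0 < t1 ->
  (forall x y, 0 <= x <= 1 -> 0 <= y <= 1 -> Rabs (f x - f y) <= K * Rabs (x - y)) ->
  nonneg_solution N f u -> (forall t x, 0 < t -> u t x <= 1) ->
  (forall t x, 0 < t -> 2 * sqnorm x <= l0 + t -> a <= u (t1 + t) x) -> 0 < l0 ->
  converges_loc_unif_to_1 u.
Proof.
  intros Hb HM Ha Ht1 HK Hu Hu1 Hspread Hl0 Rad eta HRad Heta.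
  set (e := Rmin (eta / 2) (1 / 4)).
  assert (He : 0 < e <= 1 / 4).
  { split; [apply Rmin_pos; lra | apply Rmin_r]. }
  assert (Hee : e <= eta / 2) by apply Rmin_l.
  destruct (power_lower_bound f (b + 1) (1 - e / 2) HM) as (c & Hc & Hf); [lra|].
  destruct (growth b (1 - e / 2) (1 - e) Hb) as (e2 & He2 & Hgrow); try lra.
  set (g := c * b * Rpower a b / 8).
  pose proof (Rpower_pos a b) as Hab.
  assert (Hg : 0 < g).
  { assert (0 < c * b * Rpower a b) by (repeat apply Rmult_lt_0_compat; lra). unfold g. lra. }
  (* [q] is the value of l at which exp (N / 4 + g Rad^2 - g l / 2) equals e2 a^b. *)
  set (q := 2 / g * (INR N / 4 + g * Rad ^ 2 - ln (e2 * Rpower a b))).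
  set (l := Rmax 1 q).
  assert (Hl : 1 <= l) by apply Rmax_l. assert (Hlq : q <= l) by apply Rmax_r.
  set (T := (Rpower a (- b) - Rpower (1 - e / 2) (- b)) / (c * b)).
  assert (HT : 0 < T).
  (* Positivity of [T] is part of the conclusion of [growth], read off from one admissible
     restart. *)
  { destruct (Hgrow N f c K a l (fun t x => u (t1 + 2 * l + t) x)) as [H _];
      try easy; try lra.
    - apply (nonneg_solution_shift N f u); [lra | easy].
    - apply (shift_starts_above N f u); [lra | easy|]. intros x Hx. apply Hspread; lra. }
  exists (t1 + T + 2 * l). intros t x Ht Hx.
  set (s := t - t1 - T). assert (Hs : 2 * l < s) by (unfold s; lra).
  destruct (Hgrow N f c K a l (fun t x => u (t1 + s + t) x)) as [_ H]; try easy; try lra.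
  - apply (nonneg_solution_shift N f u); [lra | easy].
  - apply (shift_starts_above N f u); [lra | easy|]. intros y Hy. apply Hspread; lra.
  - specialize (H x). fold g in H. fold T in H.
    replace (t1 + s + T) with t in H by (unfold s; ring).
    specialize (Hu1 t x ltac:(lra)).
    assert (1 - e <= u t x); [|apply Rabs_def1; lra].
    apply H. rewrite <- (exp_ln (e2 * Rpower a b)) by (apply Rmult_lt_0_compat; lra).
    apply exp_le_mono.
    assert (Hq : g * q / 2 = INR N / 4 + g * Rad ^ 2 - ln (e2 * Rpower a b))
      by (unfold q; field; lra).
    assert (g * q <= g * l) by (apply Rmult_le_compat_l; lra).
    assert (g * sqnorm x <= g * Rad ^ 2) by (apply Rmult_le_compat_l; lra).
    lra.
Qed.

(** * The threshold radius and the chaining of the three stages *)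

Theorem theorem6p3 (N : nat) (f : R -> R) (p : R) :
  (1 <= N)%nat ->
  assumption_M f p ->
  exists (Cplus eps0 : R) (Leps : R -> R),
    0 < Cplus /\ 0 < eps0 /\
    (forall eps, 0 < eps < eps0 ->
       0 < Leps eps /\
       forall L, Leps eps < L ->
         forall u : R -> RN N -> R,
           is_solution N f (ball_data eps L) u ->
           converges_loc_unif_to_1 u) /\
    (* L_eps ~ C+ eps^{-(p-1)/2} (ln (1/eps))^{1/2} as eps -> 0+ *)
    (forall eta, 0 < eta -> exists d, 0 < d /\
       forall eps, 0 < eps < d -> eps < eps0 ->
         Rabs (Leps eps / (Cplus * Rpower eps (- ((p - 1) / 2)) * sqrt (ln (1 / eps))) - 1)
           < eta).
Proof.
  intros HN HM. pose proof HM as (Hp & Hlip & Hf0 & Hf1 & _).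
  set (b := p - 1). assert (Hb : 0 < b) by (unfold b; lra).
  replace p with (b + 1) in HM by (unfold b; ring).
  destruct (Hlip 0 1) as [K HK].
  assert (HK' : forall x y, 0 <= x <= 1 -> 0 <= y <= 1 -> Rabs (f x - f y) <= K * Rabs (x - y))
    by (intros x y Hx Hy; now apply HK).
  (* The levels: growth stays below 1/2 and reaches 1/4, spreading from 1/4 keeps (1/4) / 8 = 1/32,
     and invasion starts from 1/32. *)
  destruct (power_lower_bound f (b + 1) (1 / 2) HM) as (c & Hc & Hf); [lra|].
  destruct (growth b (1 / 2) (1 / 4) Hb) as (e1 & He1 & Hgrow); try lra.
  destruct (spreading N f c (b + 1) (1 / 4) K) as (l0 & Hl0 & Hspread); try easy; try lra.
  { intros v Hv. apply Hf. lra. }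
  set (k := c * b). assert (Hk : 0 < k) by (unfold k; nra).
  pose proof (pos_INR N) as Hn.
  (* With g = k eps^b / 8 and l = L_eps^2 this gives g l / 2 = (b + 1) ln (1/eps), hence exp (- g l
     / 2) = eps^b eps: a factor eps better than what [growth] requires. *)
  set (C2 := 16 * (b + 1) / k).
  assert (HC2 : 0 < C2) by (apply Rdiv_lt_0_compat; lra).
  (* For eps < e0 the spare factor eps absorbs exp (N / 4) and exp (g |y|^2) on |y|^2 < l0, where g
     <= k / 8. *)
  set (e0 := e1 * exp (- (INR N / 4 + k * l0 / 8))).
  assert (He0 : 0 < e0) by (apply Rmult_lt_0_compat; [easy | apply exp_pos]).
  set (Leps := fun eps => sqrt C2 * Rpower eps (- (b / 2)) * sqrt (ln (1 / eps))).
  assert (Hpos : forall eps, 0 < eps < 1 -> 0 < Leps eps /\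
    Leps eps ^ 2 = C2 * Rpower eps (- b) * - ln eps).
  { intros eps Heps.
    assert (Hln : ln (1 / eps) = - ln eps).
    { unfold Rdiv. rewrite Rmult_1_l. apply ln_Rinv. lra. }
    assert (Hln0 : 0 < - ln eps) by (pose proof ln_1; pose proof (ln_increasing eps 1); lra).
    unfold Leps. rewrite Hln. pose proof (Rpower_pos eps (- (b / 2))). split.
    - repeat apply Rmult_lt_0_compat; try easy; apply sqrt_lt_R0; lra.
    - rewrite !Rpow_mult_distr, !pow2_sqrt by lra.
      replace (Rpower eps (- b)) with (Rpower eps (- (b / 2)) ^ 2); [easy|].
      rewrite <- Rpower_pow, Rpower_mult by easy. f_equal. simpl. field. }
  exists (sqrt C2), (Rmin (1 / 2) e0), Leps.
  split; [now apply sqrt_lt_R0|]. split; [apply Rmin_pos; lra|]. split.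
  - intros eps Heps. pose proof (Rmin_l (1 / 2) e0). pose proof (Rmin_r (1 / 2) e0).
    destruct (Hpos eps) as [HL0 HL2]; [lra|]. split; [easy|]. intros L HL u Hu.
    (* Only the data in |x| < L_eps are used, so one time T serves for every L > L_eps. *)
    set (l := Leps eps ^ 2) in *. assert (Hl : 0 < l) by (unfold l; nra).
    assert (Hsol : nonneg_solution N f u).
    { apply (solution_nonneg_solution N f eps L); try easy; lra. }
    assert (Habove : starts_above u eps l).
    { apply (solution_starts_above N f eps L); [unfold l in *; nra | easy]. }
    destruct (Hgrow N f c K eps l u) as [HT Hg]; try easy; try lra.
    set (T := (Rpower eps (- b) - Rpower (1 / 2) (- b)) / (c * b)) in *.
    apply (invasion N f u b T l0 (1 / 32) K); try easy; try lra.
    + intros t x Ht. apply (solution_bounds N f eps L u); try easy; lra.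
    + intros t x Ht Hx. replace (1 / 32) with (1 / 4 / 8) by field.
      apply (Hspread (fun t x => u (T + t) x)); try easy.
      * apply (nonneg_solution_shift N f u); [lra | easy].
      * apply (shift_starts_above N f u); try easy. intros y Hy. apply Hg. fold k.
        pose proof (Rpower_pos eps b) as Hpe.
        assert (Hpe1 : Rpower eps b <= 1) by (apply Rpower_le_1; lra).
        assert (Hgl : k * Rpower eps b / 8 * l / 2 = - ((b + 1) * ln eps)).
        { rewrite HL2. unfold C2. rewrite Rpower_Ropp. field. lra. }
        rewrite Hgl.
        apply Rle_trans with (exp (INR N / 4 + k * l0 / 8) * (Rpower eps b * eps)).
        -- replace (Rpower eps b * eps) with (exp ((b + 1) * ln eps))
             by (fold (Rpower eps (b + 1)); rewrite Rpower_plus, Rpower_1 by lra; ring).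
           rewrite <- exp_plus. apply exp_le_mono.
           pose proof (sqnorm_nonneg N y).
           assert (k * Rpower eps b / 8 * sqnorm y <= k * l0 / 8); [|lra].
           assert (k * Rpower eps b <= k) by nra.
           assert (0 < k * Rpower eps b) by nra. nra.
        -- replace e1 with (exp (INR N / 4 + k * l0 / 8) * e0).
           ++ pose proof (exp_pos (INR N / 4 + k * l0 / 8)).
              assert (Rpower eps b * eps <= Rpower eps b * e0) by (apply Rmult_le_compat_l; lra).
              nra.
           ++ unfold e0. rewrite (Rmult_comm e1), <- Rmult_assoc, <- exp_plus, Rplus_opp_r, exp_0.
              ring.
  (* The radius is defined by its asymptotic expression, so the ratio is exactly 1; eps < 1 makes
     the logarithm positive and the divisor nonzero. *)
  - intros eta Heta. exists 1. split; [lra|]. intros eps Heps _.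
    destruct (Hpos eps Heps) as [HL0 _]. fold b. fold (Leps eps).
    replace (Leps eps / Leps eps - 1) with 0 by (field; lra). now rewrite Rabs_R0.
Qed.
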